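(* $(c>0)$-\textsc{McfEnum} is in \textbf{PSDelayP}: there is an algorithm that, given a weighted temporal graph $G=(V,E)$ in which every edge has strictly positive cost and vertices $s,z\in V$, enumerates exactly all $(s,z)$-paths that are efficient with respect to duration and cost, such that the time until the first output and between any two consecutive outputs is bounded by a polynomial in the input size, and the space used is bounded by a polynomial in the input size.
   Context: A weighted temporal graph $G=(V,E)$ has temporal edges $e=(u,v,t,\lambda,c)$ with $u\neq v$, availability time $t\in\mathbb{N}$, traversal time $\lambda\in\mathbb{N}$, cost $c\in\mathbb{R}_{\ge0}$; it is given as the sequence of its edges sorted by availability time. A temporal $(u,v)$-path is a sequence $(e_1,\ldots,e_k)$, $e_i=(v_i,v_{i+1},t_i,\lambda_i,c_i)\in E$, $v_1=u$, $v_{k+1}=v$, $t_i+\lambda_i\le t_{i+1}$ for $1\le i<k$, visiting each vertex at most once; starting time $s(P)=t_1$, arrival time $a(P)=t_k+\lambda_k$, duration $d(P)=a(P)-s(P)$, cost $c(P)=\sum_i c_i$. An $(s,z)$-path $P$ is efficient w.r.t. duration and cost if no $(s,z)$-path $Q$ has ($c(Q)<c(P)$ and $d(Q)\le d(P)$) or ($c(Q)\le c(P)$ and $d(Q)<d(P)$). \textsc{McfEnum} is the task of enumerating all and only these efficient $(s,z)$-paths; $(c>0)$-\textsc{McfEnum} is its restriction to graphs with all edge costs strictly positive. An enumeration problem is in \textbf{PSDelayP} if the delay before the first and between any two consecutive outputs is polynomial in the input size and the space used is polynomial in the input size. *)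

(* Defs.v *)
From HB Require Import structures.
From mathcomp Require Import all_boot all_order all_algebra.
From mathcomp Require Import reals.

Set Implicit Arguments.
Unset Strict Implicit.
Unset Printing Implicit Defensive.
Import Order.TTheory GRing.Theory Num.Theory.

Record tedge (R : realType) (n : nat) := TEdge {
  src : 'I_n;
  tgt : 'I_n;
  avail : nat;
  trav : nat;
  cost : R
}.

Definition tedge_tuple (R : realType) (n : nat) (e : tedge R n) :=
  (src e, tgt e, avail e, trav e, cost e).
Definition tuple_tedge (R : realType) (n : nat)
    (x : 'I_n * 'I_n * nat * nat * R) : tedge R n :=
  let: (u, v, t, l, c) := x in TEdge u v t l c.
Lemma tedge_tupleK (R : realType) (n : nat) :
  cancel (@tedge_tuple R n) (@tuple_tedge R n).
Proof. by case. Qed.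
HB.instance Definition _ (R : realType) (n : nat) :=
  Equality.copy (tedge R n) (can_type (@tedge_tupleK R n)).

(* The edge set is presented as a duplicate-free sequence, sorted by
   availability time; ties may be ordered arbitrarily. *)
Record tgraph (R : realType) := TGraph {
  nvert : nat;
  edges : seq (tedge R nvert);
  edges_uniq : uniq edges;
  edges_sorted : sorted leq [seq avail e | e <- edges];
  edges_loopless : forall e, e \in edges -> src e != tgt e;
  edges_cost_ge0 : forall e, e \in edges -> (0 <= cost e)%R
}.

Section Paths.
Variables (R : realType) (G : tgraph R).
Local Notation edge := (tedge R (nvert G)).
Implicit Types (u v : 'I_(nvert G)) (P Q : seq edge).

Definition follows (e e' : edge) : bool :=
  (tgt e == src e') && (avail e + trav e <= avail e').

(* Paths have at least one edge (otherwise starting and arrival times are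
   undefined), so that there is no path from a vertex to itself. *)
Definition tpath u v P : bool :=
  if P is e :: es then
    [&& all (fun e' => e' \in edges G) P, src e == u, tgt (last e es) == v,
        path follows e es & uniq (src e :: [seq tgt e' | e' <- P])]
  else false.

Definition start_time P : nat := if P is e :: _ then avail e else 0.
Definition arrival_time P : nat :=
  if P is e :: es then avail (last e es) + trav (last e es) else 0.
Definition duration P : nat := arrival_time P - start_time P.
Definition path_cost P : R := (\sum_(e <- P) cost e)%R.

Definition efficient u v P : Prop :=
  tpath u v P /\
  ~ exists Q, tpath u v Q /\
      ((path_cost Q < path_cost P)%R /\ duration Q <= duration P \/
       (path_cost Q <= path_cost P)%R /\ duration Q < duration P).

End Paths.

(* A RAM in structured form.  Memory consists of arrays of naturals and arrays
   of reals, both named by naturals; a scalar variable is cell 0 of an array.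
   Reals can only be copied, added and compared, and 0 is the only real
   constant. *)

Inductive nexp :=
  | NConst of nat
  | NCell of nat & nexp            (* array name, index *)
  | NAdd of nexp & nexp
  | NSub of nexp & nexp            (* truncated *)
  | NMul of nexp & nexp.

Inductive rexp :=
  | RZero
  | RCell of nat & nexp
  | RAdd of rexp & rexp.

Inductive bexp :=
  | BNLe of nexp & nexp
  | BRLe of rexp & rexp
  | BNot of bexp
  | BAnd of bexp & bexp.

Inductive cmd :=
  | CSkip
  | CNSet of nat & nexp & nexp     (* array name, index, value *)
  | CRSet of nat & nexp & rexp
  | CEmit of nexp                  (* append a number to the current output *)
  | CYield                         (* complete the current output *)
  | CSeq of cmd & cmd
  | CIf of bexp & cmd & cmd
  | CWhile of bexp & cmd.

Record store (R : Type) := Store { nmem : seq (seq nat); rmem : seq (seq R) }.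

(* Cells that were never written contain 0.  Writing cell [i] of an array
   allocates all the cells of that array up to [i]. *)
Definition rd (T : Type) (x0 : T) (M : seq (seq T)) (a i : nat) : T :=
  nth x0 (nth [::] M a) i.
Definition wr (T : Type) (x0 : T) (M : seq (seq T)) (a i : nat) (x : T) :=
  set_nth [::] M a (set_nth x0 (nth [::] M a) i x).

Section Machine.
Variable R : realType.
Implicit Type s : store R.

Fixpoint neval s (e : nexp) : nat :=
  match e with
  | NConst k => k
  | NCell a i => rd 0 (nmem s) a (neval s i)
  | NAdd e1 e2 => neval s e1 + neval s e2
  | NSub e1 e2 => neval s e1 - neval s e2
  | NMul e1 e2 => neval s e1 * neval s e2
  end.

Fixpoint reval s (r : rexp) : R :=
  match r with
  | RZero => 0%R
  | RCell a i => rd 0%R (rmem s) a (neval s i)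
  | RAdd r1 r2 => (reval s r1 + reval s r2)%R
  end.

Fixpoint beval s (b : bexp) : bool :=
  match b with
  | BNLe e1 e2 => neval s e1 <= neval s e2
  | BRLe r1 r2 => (reval s r1 <= reval s r2)%R
  | BNot b1 => ~~ beval s b1
  | BAnd b1 b2 => beval s b1 && beval s b2
  end.

(* [todo] is the remaining program, as a stack of commands; [todo = [::]] means
   that the machine has halted.  [pending] and [outs] form a write-only output
   device; each completed output is stamped with the step that completed it. *)
Record config := Config {
  todo : seq cmd;
  memory : store R;
  clock : nat;
  pending : seq nat;
  outs : seq (nat * seq nat)
}.

Definition step (c : config) : config :=
  let: Config k s t w o := c in
  match k with
  | [::] => c
  | CSkip :: k' => Config k' s t.+1 w o
  | CNSet a i e :: k' =>
      let M := wr 0 (nmem s) a (neval s i) (neval s e) in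
      Config k' (Store M (rmem s)) t.+1 w o
  | CRSet a i r :: k' =>
      let M := wr 0%R (rmem s) a (neval s i) (reval s r) in
      Config k' (Store (nmem s) M) t.+1 w o
  | CEmit e :: k' => Config k' s t.+1 (rcons w (neval s e)) o
  | CYield :: k' => Config k' s t.+1 [::] (rcons o (t.+1, w))
  | CSeq c1 c2 :: k' => Config (c1 :: c2 :: k') s t.+1 w o
  | CIf b c1 c2 :: k' => Config ((if beval s b then c1 else c2) :: k') s t.+1 w o
  | CWhile b c1 :: k' =>
      Config (if beval s b then c1 :: k else k') s t.+1 w o
  end.

Definition run (prog : cmd) (s : store R) (t : nat) : config :=
  iter t step (Config [:: prog] s 0 [::] [::]).

Definition bitlen (k : nat) : nat := (trunc_log 2 k).+1.

(* A cell with a natural number occupies as many units as the number has bits,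
   a cell with a real number occupies one unit.  Under a polynomial space
   bound every step therefore handles only naturals of polynomial length, so
   that counting steps agrees, up to a polynomial, with charging operations on
   naturals by bit length.  The stack [todo] is not counted: its height is
   bounded by the program. *)
Definition store_space s : nat :=
  (\sum_(a <- nmem s) \sum_(k <- a) bitlen k) + \sum_(a <- rmem s) size a.

(* The waiting time before the first output, then between consecutive ones. *)
Definition delays (c : config) : seq nat :=
  pairmap (fun t t' => t' - t) 0 (unzip1 (outs c)).

End Machine.

Record enum_problem (R : realType) := EnumProblem {
  inst : Type;
  inst_store : inst -> store R;    (* initial memory *)
  inst_size : inst -> nat;
  sol : inst -> eqType;
  sol_code : forall x : inst, sol x -> seq nat;   (* how a solution is output *)
  is_sol : forall x : inst, sol x -> Prop
}.
Arguments sol_code {R} _ x _.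
Arguments is_sol {R} _ x _.

Definition restrict (R : realType) (Pi : enum_problem R)
    (P : inst Pi -> Prop) : enum_problem R :=
  @EnumProblem R {x : inst Pi | P x}
    (fun x => inst_store (sval x)) (fun x => inst_size (sval x))
    (fun x => sol (sval x)) (fun x => sol_code Pi (sval x))
    (fun x => is_sol Pi (sval x)).

(* On every instance the run halts, having output every solution exactly once
   and nothing else. *)
Definition PSDelayP (R : realType) (Pi : enum_problem R) : Prop :=
  exists (prog : cmd) (pd ps : {poly nat}),
  forall x : inst Pi,
  exists (T : nat) (ys : seq (sol x)),
  let c := run prog (inst_store x) in
  [/\ todo (c T) = [::],
      uniq ys /\ (forall y, y \in ys <-> is_sol Pi x y),
      unzip2 (outs (c T)) = [seq sol_code Pi x y | y <- ys],
      forall d, d \in delays (c T) -> d <= pd.[inst_size x]%R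
    & forall t, t <= T -> store_space (memory (c t)) <= ps.[inst_size x]%R].

Record mcf_inst (R : realType) := McfInst {
  mcf_graph : tgraph R;
  mcf_s : 'I_(nvert mcf_graph);
  mcf_z : 'I_(nvert mcf_graph)
}.

Definition mcf_store (R : realType) (x : mcf_inst R) : store R :=
  let E := edges (mcf_graph x) in
  Store [:: [:: nvert (mcf_graph x); size E; val (mcf_s x); val (mcf_z x)];
            [seq val (src e) | e <- E]; [seq val (tgt e) | e <- E];
            [seq avail e | e <- E]; [seq trav e | e <- E]]
        [:: [seq cost e | e <- E]].

(* One unit per vertex plus the space occupied by the edges, [s] and [z]. *)
Definition mcf_size (R : realType) (x : mcf_inst R) : nat :=
  nvert (mcf_graph x) + store_space (mcf_store x).

(* A path is output as the sequence of the positions of its edges in the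
   input; this is injective since the input has no repeated edge. *)
Definition McfEnum (R : realType) : enum_problem R :=
  @EnumProblem R (mcf_inst R) (@mcf_store R) (@mcf_size R)
    (fun x => seq (tedge R (nvert (mcf_graph x))))
    (fun x P => [seq index e (edges (mcf_graph x)) | e <- P])
    (fun x P => efficient (mcf_s x) (mcf_z x) P).

Definition cpos_McfEnum (R : realType) : enum_problem R :=
  @restrict R (McfEnum R)
    (fun x : mcf_inst R =>
       forall e, e \in edges (mcf_graph x) -> (0 < cost e)%R).

(* Main.v *)
(* With positive costs, deleting a cycle from a walk from s to z makes it
   strictly cheaper without making it longer in time.  Hence, for s <> z, the
   efficient paths are exactly the walks from s to z which, for some first edge
   e and last edge f, have the least cost D(e, f) of a walk from e to f, where
   no pair (e', f') is better than (e, f) for D and for the duration.  The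
   matrix D and the set of nondominated pairs are computed in advance, by
   relaxation over pairs of edges.  A walk v with first edge e and last edge c
   is then a prefix of an efficient path if and only if for some nondominated
   pair (e, f) the cost of v up to c, excluded, plus D(c, f) is at most D(e, f).
   Depth-first search through the words in the edges, pruned by this test,
   never enters a branch without a solution, so that only polynomially many
   steps separate two outputs. *)
Require Import Defs.
From mathcomp Require Import all_boot all_order all_algebra.
From mathcomp Require Import boolp reals.
From mathcomp Require Import zify lra.

Set Implicit Arguments.
Unset Strict Implicit.
Unset Printing Implicit Defensive.
Import Order.TTheory GRing.Theory Num.Theory.

Notation gn s := (rd 0 (nmem s)).
Notation gr s := (rd 0%R (rmem s)).

(** A table of least costs cannot tell whether a prefix extends to a path that avoids the vertices
    already visited. The search therefore keeps no record of visited vertices: the table ranges over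
    arbitrary walks, and simplicity is a consequence of optimality. Traversal times may be 0, so a
    walk can run around a cycle within one instant, and availability times give no order in which
    the table could be filled in a single pass; hence the rounds of relaxation. Two measures of the
    search are kept apart. A polynomial potential bounds the number of moves up to the next output,
    while termination rests on an exponential one, since there may be exponentially many
    solutions. *)

Lemma rd_wr (T : Type) (x0 : T) M a i x b j :
  rd x0 (wr x0 M a i x) b j =
  if (b == a) && (j == i) then x else rd x0 M b j.
Proof.
rewrite /rd /wr nth_set_nth /=; case: (b =P a) => [->|//].
by rewrite nth_set_nth.
Qed.

(** Writes beyond the input arrays thus leave the input as a literal prefix of the memory. *)
Lemma set_nth_cat (T : Type) (x0 : T) s t i x :
  set_nth x0 (s ++ t) (size s + i) x = s ++ set_nth x0 t i x.
Proof. by elim: s => //= y s ->. Qed.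

(** * Loop programs and their compilation *)

Definition nvar a := NCell a (NConst 0).
Definition medges := NCell 0 (NConst 1).
Definition idx_guard i :=
  BNLe i (NMul (NAdd medges (NConst 1)) (NAdd medges (NConst 1))).
Definition val_guard e := BNLe e (NAdd medges (NConst 1)).

(* Guarding the writes makes the space bound independent of what the program
   computes; [LFor v c] runs [c] for [v] from 0 to the number of edges. *)
Inductive lcmd :=
  | LSkip
  | LSet of nat & nexp & nexp
  | LRSet of nat & nexp & rexp
  | LSeq of lcmd & lcmd
  | LIf of bexp & lcmd & lcmd
  | LFor of nat & lcmd.

Fixpoint comp (c : lcmd) : cmd :=
  match c with
  | LSkip => CSkip
  | LSet a i e => CIf (BAnd (idx_guard i) (val_guard e)) (CNSet a i e) CSkip
  | LRSet a i r => CIf (idx_guard i) (CRSet a i r) CSkip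
  | LSeq c1 c2 => CSeq (comp c1) (comp c2)
  | LIf b c1 c2 => CIf b (comp c1) (comp c2)
  | LFor v c1 =>
      CSeq (CNSet v (NConst 0) (NConst 0))
           (CWhile (BNLe (NAdd (nvar v) (NConst 1)) medges)
              (CSeq (comp c1)
                    (CNSet v (NConst 0) (NAdd (nvar v) (NConst 1)))))
  end.

(** The variable stands for the number of edges. A conditional is charged for both branches, a
    maximum of polynomials being in general no polynomial; the constants of [LFor] count
    initialisation, tests and increments. *)
Fixpoint time (c : lcmd) : {poly nat} :=
  match c with
  | LSkip => 1
  | LSet _ _ _ | LRSet _ _ _ => 2%:P
  | LSeq c1 c2 | LIf _ c1 c2 => 1 + time c1 + time c2
  | LFor _ c1 => 3%:P + 'X * (3%:P + time c1)
  end%R.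

Fixpoint nwrites (c : lcmd) : seq nat :=
  match c with
  | LSkip | LRSet _ _ _ => [::]
  | LSet a _ _ => [:: a]
  | LSeq c1 c2 | LIf _ c1 c2 => nwrites c1 ++ nwrites c2
  | LFor v c1 => v :: nwrites c1
  end.

Fixpoint rwrites (c : lcmd) : seq nat :=
  match c with
  | LSkip | LSet _ _ _ => [::]
  | LRSet a _ _ => [:: a]
  | LSeq c1 c2 | LIf _ c1 c2 => rwrites c1 ++ rwrites c2
  | LFor v c1 => rwrites c1
  end.

(* Arrays 0 to 4 of naturals and array 0 of reals hold the input. *)
Fixpoint wf (c : lcmd) : bool :=
  match c with
  | LSkip => true
  | LSet a _ _ => 5 <= a < 16
  | LRSet a _ _ => 1 <= a < 4
  | LSeq c1 c2 | LIf _ c1 c2 => wf c1 && wf c2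
  | LFor v c1 => [&& 5 <= v < 16, v \notin nwrites c1 & wf c1]
  end.

(** * Denotational semantics of loop programs *)

Section Lang.
Variable R : realType.
Implicit Type s : store R.

Definition setn s a i x := Store (wr 0 (nmem s) a i x) (rmem s).
Definition setr s a i x := Store (nmem s) (wr 0%R (rmem s) a i x).

(** The number of iterations is read once, before the loop. This agrees with the compiled [CWhile]
    because [wf] protects the input cell holding the number of edges and keeps the counter out of
    the writes of the body. *)
Fixpoint den (c : lcmd) s : store R :=
  match c with
  | LSkip => s
  | LSet a i e =>
      if beval s (BAnd (idx_guard i) (val_guard e))
      then setn s a (neval s i) (neval s e) else s
  | LRSet a i r =>
      if beval s (idx_guard i) then setr s a (neval s i) (reval s r) else s
  | LSeq c1 c2 => den c2 (den c1 s)
  | LIf b c1 c2 => if beval s b then den c1 s else den c2 s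
  | LFor v c1 =>
      iter (gn s 0 1)
        (fun s' => setn (den c1 s') v 0 (gn (den c1 s') v 0 + 1))
        (setn s v 0 0)
  end.

Lemma gn_setn s a i x b j :
  gn (setn s a i x) b j = if (b == a) && (j == i) then x else gn s b j.
Proof. exact: rd_wr. Qed.

Lemma gr_setr s a i x b j :
  gr (setr s a i x) b j = if (b == a) && (j == i) then x else gr s b j.
Proof. exact: rd_wr. Qed.

Lemma gn_setr s a i x : gn (setr s a i x) = gn s. Proof. by []. Qed.
Lemma gr_setn s a i x : gr (setn s a i x) = gr s. Proof. by []. Qed.

Lemma gn_den c s a i : a \notin nwrites c -> gn (den c s) a i = gn s a i.
Proof.
elim: c s => [|b k e|b k r|c1 IH1 c2 IH2|b c1 IH1 c2 IH2|v c IH] s.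
- by [].
- rewrite inE => /negPf ab; rewrite [den _ _]/=; case: ifP => // _.
  by rewrite gn_setn ab.
- by rewrite [den _ _]/=; case: ifP.
- by rewrite mem_cat negb_or => /andP[h1 h2]; rewrite [LHS]/= IH2 ?IH1.
- rewrite mem_cat negb_or => /andP[h1 h2] /=.
  by case: ifP => _; rewrite ?IH1 ?IH2.
- rewrite inE negb_or => /andP[/negPf av h] /=.
  have: gn (setn s v 0 0) a i = gn s a i by rewrite gn_setn av.
  elim: (gn s 0 1) => [//|n IHn] e /=.
  by rewrite gn_setn av IH ?IHn.
Qed.

Lemma gr_den c s a i : a \notin rwrites c -> gr (den c s) a i = gr s a i.
Proof.
elim: c s => [|b k e|b k r|c1 IH1 c2 IH2|b c1 IH1 c2 IH2|v c IH] s.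
- by [].
- by rewrite [den _ _]/=; case: ifP.
- rewrite inE => /negPf ab; rewrite [den _ _]/=; case: ifP => // _.
  by rewrite gr_setr ab.
- by rewrite mem_cat negb_or => /andP[h1 h2]; rewrite [LHS]/= IH2 ?IH1.
- rewrite mem_cat negb_or => /andP[h1 h2] /=.
  by case: ifP => _; rewrite ?IH1 ?IH2.
- move=> h /=.
  by elim: (gn s 0 1) => [//|n IHn]; apply: etrans (IH _ h) IHn.
Qed.

Lemma wf_writes c : wf c ->
  all (fun a => 5 <= a) (nwrites c) && all (fun a => 1 <= a) (rwrites c).
Proof.
elim: c => [|b k e|b k r|c1 IH1 c2 IH2|b c1 IH1 c2 IH2|v c IH] //=.
- by case/andP => ->.
- by case/andP => ->.
- case/andP => /IH1/andP[h1 h2] /IH2/andP[h3 h4].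
  by rewrite !all_cat h1 h2 h3 h4.
- case/andP => /IH1/andP[h1 h2] /IH2/andP[h3 h4].
  by rewrite !all_cat h1 h2 h3 h4.
- by case/and3P => /andP[-> _] _ /IH.
Qed.

Lemma wf_gn c s a i : wf c -> a < 5 -> gn (den c s) a i = gn s a i.
Proof.
move=> /wf_writes/andP[/allP h _] a5; apply: gn_den.
by apply/negP => /h; rewrite leqNgt a5.
Qed.

Lemma wf_gr c s i : wf c -> gr (den c s) 0 i = gr s 0 i.
Proof.
move=> /wf_writes/andP[_ /allP h]; apply: gr_den.
by apply/negP => /h.
Qed.

(** The counter is written outside the body, on entry and after each round, so the invariant has to
    be stable under any write to it; in return the body may assume that the counter equals [i]. *)
Lemma for_rule (I : nat -> store R -> Prop) v c s :
  wf (LFor v c) -> I 0 s ->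
  (forall i s' x, I i s' -> I i (setn s' v 0 x)) ->
  (forall i s', i < gn s 0 1 -> gn s' v 0 = i -> I i s' -> I i.+1 (den c s')) ->
  I (gn s 0 1) (den (LFor v c) s).
Proof.
move=> /= /and3P[_ vc wc] I0 Iv Is; set f := fun _ => _.
suff: forall i, i <= gn s 0 1 ->
  gn (iter i f (setn s v 0 0)) v 0 = i /\ I i (iter i f (setn s v 0 0)).
  by move=> /(_ _ (leqnn _))[].
elim=> [|i IH] /=; first by rewrite gn_setn !eqxx; split=> //; apply: Iv.
move=> im; have [e Ii] := IH (ltnW im); rewrite /f gn_setn !eqxx /=.
by rewrite gn_den // e addn1; split=> //; apply/Iv/Is.
Qed.

(** * Time and space of compiled programs *)

Section Exec.
Variable s0 : store R.
Hypothesis s0n : size (nmem s0) = 5.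
Hypothesis s0r : size (rmem s0) = 1.
Let m := gn s0 0 1.
Let B := (m.+1 * m.+1).+1.

(** The 11 and 3 are the numbers of scratch arrays that [wf] admits, 5 to 15 and 1 to 3. The guard
    admits indices up to [m.+1 * m.+1], and a write allocates all cells below, whence the length
    [B]. *)
Definition bounded s : Prop := exists Mn Mr,
  [/\ nmem s = nmem s0 ++ Mn, rmem s = rmem s0 ++ Mr,
      size Mn <= 11 /\ size Mr <= 3,
      forall a, size (nth [::] Mn a) <= B /\
                forall i, nth 0 (nth [::] Mn a) i <= m.+1
    & forall a, size (nth [::] Mr a) <= B].

Lemma bounded0 : bounded s0.
Proof.
exists [::], [::]; rewrite !cats0; split=> // a; rewrite nth_nil //.
by split=> // i; rewrite nth_nil.
Qed.

Lemma bounded_setn s a i x : bounded s -> 5 <= a < 16 ->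
  i <= m.+1 * m.+1 -> x <= m.+1 -> bounded (setn s a i x).
Proof.
move=> [Mn [Mr [en er [zn zr] bn br]]] /andP[a5 a16] iB xm.
exists (set_nth [::] Mn (a - 5) (set_nth 0 (nth [::] Mn (a - 5)) i x)), Mr.
split=> //=.
- rewrite /wr en -{1}(subnKC a5) -{1}s0n set_nth_cat nth_cat s0n.
  by rewrite ltnNge a5.
- by rewrite size_set_nth; lia.
move=> b; rewrite nth_set_nth /=; case: eqP => _; last exact: bn.
have [h1 h2] := bn (a - 5).
split; first by rewrite size_set_nth /B geq_max ltnS iB.
by move=> j; rewrite nth_set_nth /=; case: eqP.
Qed.

Lemma bounded_setr s a i x : bounded s -> 1 <= a < 4 ->
  i <= m.+1 * m.+1 -> bounded (setr s a i x).
Proof.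
move=> [Mn [Mr [en er [zn zr] bn br]]] /andP[a5 a16] iB.
exists Mn, (set_nth [::] Mr (a - 1) (set_nth 0%R (nth [::] Mr (a - 1)) i x)).
split=> //=.
- rewrite /wr er -{1}(subnKC a5) -{1}s0r set_nth_cat nth_cat s0r.
  by rewrite ltnNge a5.
- by rewrite size_set_nth; lia.
move=> b; rewrite nth_set_nth /=; case: eqP => _; last exact: br.
by rewrite size_set_nth /B geq_max ltnS iB br.
Qed.

Lemma bounded_gn s a i : bounded s -> a < 5 -> gn s a i = gn s0 a i.
Proof. by move=> [Mn [Mr [en _ _ _ _]]] a5; rewrite /rd en nth_cat s0n a5. Qed.

Lemma bitlen_le k : bitlen k <= k.+1.
Proof. 
rewrite /bitlen ltnS; case: k => // k.
by apply: ltnW; apply: leq_trans (trunc_logP (ltnSn 1) (ltn0Sn k)); apply: ltn_expl.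
Qed.

(** A natural up to [m.+1] takes at most [m.+2] bits by the crude bound [bitlen k <= k.+1], which is
    good enough for a polynomial. *)
Lemma bounded_space s : bounded s ->
  store_space s <= store_space s0 + 11 * (B * m.+2) + 3 * B.
Proof.
move=> [Mn [Mr [en er [zn zr] bn br]]].
rewrite /store_space en er !big_cat /=.
have h1 : \sum_(a <- Mn) \sum_(k <- a) bitlen k <= 11 * (B * m.+2).
  apply: leq_trans (_ : \sum_(a <- Mn) B * m.+2 <= _); last first.
    by rewrite big_const_seq count_predT iter_addn_0 mulnC leq_mul2r zn orbT.
  rewrite big_seq [leqRHS]big_seq; apply: leq_sum => a /(nthP [::])[j jM <-].
  have [h1 h2] := bn j.
  apply: leq_trans (_ : \sum_(k <- nth [::] Mn j) m.+2 <= _).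
    rewrite big_seq [leqRHS]big_seq; apply: leq_sum => k /(nthP 0)[l _ <-].
    by apply: leq_trans (bitlen_le _) _; rewrite ltnS.
  by rewrite big_const_seq count_predT iter_addn_0 mulnC leq_mul2r h1 orbT.
have h2 : \sum_(a <- Mr) size a <= 3 * B.
  apply: leq_trans (_ : \sum_(a <- Mr) B <= _); last first.
    by rewrite big_const_seq count_predT iter_addn_0 mulnC leq_mul2r zr orbT.
  by rewrite big_seq [leqRHS]big_seq; apply: leq_sum => a /(nthP [::])[j jM <-].
by rewrite addnACA -[leqRHS]addnA leq_add2l leq_add.
Qed.

(** The intermediate configurations are included because the space bound must hold at every step,
    not only between commands. *)
Definition exec (c : config R) n c' :=
  iter n (@step R) c = c' /\ forall j, j <= n -> bounded (memory (iter j (@step R) c)).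

Lemma exec0 c : bounded (memory c) -> exec c 0 c.
Proof. by move=> bc; split=> // j; rewrite leqn0 => /eqP->. Qed.

Lemma exec_trans c1 n1 c2 n2 c3 :
  exec c1 n1 c2 -> exec c2 n2 c3 -> exec c1 (n1 + n2) c3.
Proof.
move=> [e1 b1] [e2 b2]; split=> [|j]; first by rewrite addnC iterD e1.
move=> jn; case: (leqP j n1) => [/b1//|/ltnW n1j].
by rewrite -(subnK n1j) iterD e1; apply: b2; rewrite leq_subLR.
Qed.

Lemma exec_step c n c' : bounded (memory c) -> exec (step c) n c' -> exec c n.+1 c'.
Proof.
move=> bc [e b]; split=> [|[|j]] //; rewrite iterSr //.
by rewrite ltnS => /b.
Qed.

Lemma exec_bounded c n c' : exec c n c' -> bounded (memory c').
Proof. by case=> <- /(_ n (leqnn n)). Qed.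

Lemma comp_exec c s k t w o : wf c -> bounded s ->
  exists2 n, n <= ((time c).[m])%R &
    exec (Config (comp c :: k) s t w o) n (Config k (den c s) (t + n) w o).
Proof.
elim: c s k t => [|a i e|a i r|c1 IH1 c2 IH2|b c1 IH1 c2 IH2|v c IH] s k t.
- exists 1; first by rewrite hornerC.
  by apply: exec_step => //=; rewrite addn1; apply: exec0.
- move=> wa bs; exists 2; first by rewrite /= hornerC.
  apply: exec_step => //; rewrite [step _]/= [den _ _]/=.
  case: ifP => g; apply: exec_step => //=; rewrite addn2; apply: exec0 => //=.
  move: g; rewrite /= bounded_gn // !addn1 => /andP[g1 g2].
  exact: bounded_setn.
- move=> wa bs; exists 2; first by rewrite /= hornerC.
  apply: exec_step => //; rewrite [step _]/= [den _ _]/=.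
  case: ifP => g; apply: exec_step => //=; rewrite addn2; apply: exec0 => //=.
  move: g; rewrite /= bounded_gn // !addn1 => g1.
  exact: bounded_setr.
- move=> /= /andP[w1 w2] bs.
  have [n1 t1 x1] := IH1 s (comp c2 :: k) t.+1 w1 bs.
  have [n2 t2 x2] := IH2 _ k (t.+1 + n1) w2 (exec_bounded x1).
  exists (n1 + n2).+1; first by rewrite !hornerD hornerC /=; lia.
  apply: exec_step => //=; rewrite (_ : t + _ = t.+1 + n1 + n2); last by lia.
  exact: exec_trans x1 x2.
- move=> /= /andP[w1 w2] bs.
  case: ifP => g; [have [n tn x] := IH1 s k t.+1 w1 bs|
                   have [n tn x] := IH2 s k t.+1 w2 bs];
  exists n.+1; rewrite ?hornerD ?hornerC /=; try lia;
  by apply: exec_step => //=; rewrite g -[t + n.+1]addSnnS.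
- move=> /= /and3P[va vc wc] bs.
  set f := fun s' => setn _ _ _ _; set W := CWhile _ _; set s1 := setn s v 0 0.
  have bs1 : bounded s1 by apply: bounded_setn.
  rewrite (bounded_gn 1 bs) // -/m.
  (* Induction on the number [i] of iterations to come, the counter standing at [m - i]; the leading
     1 is the last, failing test. *)
  suff loop i s' t' : i <= m -> bounded s' -> gn s' v 0 = m - i ->
    exists2 n, n <= 1 + i * (3 + ((time c).[m])%R) &
      exec (Config (W :: k) s' t' w o) n (Config k (iter i f s') (t' + n) w o).
    have [|n tn x] := loop m s1 t.+2 (leqnn _) bs1.
      by rewrite gn_setn !eqxx subnn.
    exists n.+2.
      have -> : ((3%:P + 'X * (3%:P + time c)).[m])%R = 3 + m * (3 + ((time c).[m])%R).
        by rewrite hornerD hornerM hornerD hornerX !hornerC.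
      by rewrite -[n.+2]addn2; apply: leq_trans (leq_add tn (leqnn 2)) _; lia.
    do 2![apply: exec_step => //=].
    by rewrite -[t + n.+2]addSnnS -addSnnS.
  elim: i s' t' => [|i IHi] s' t' im bs' vs'.
    exists 1 => //; apply: exec_step => //=.
    rewrite -/(gn s') vs' bounded_gn // -/m subn0 addn1 ltnn addn1.
    exact: exec0.
  set s2 := den c s'.
  have [n1 t1 x1] := IH s'
    (CNSet v (NConst 0) (NAdd (nvar v) (NConst 1)) :: W :: k) t'.+2 wc bs'.
  have bs2 := exec_bounded x1; rewrite /= in bs2.
  have vs2 : gn s2 v 0 = m - i.+1 by rewrite gn_den.
  have bs3 : bounded (f s').
    by apply: bounded_setn => //; rewrite vs2; lia.
  have [//||n2 t2 x2] := IHi (f s') (t'.+2 + n1).+1 (ltnW im).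
      by rewrite /f gn_setn !eqxx vs2 /=; lia.
  exists (n1 + n2.+1).+2; first by lia.
  apply: exec_step => //=.
  rewrite -/(gn s') vs' bounded_gn // -/m.
  rewrite (_ : m - i.+1 + 1 <= m); last by lia.
  apply: exec_step => //=; apply: exec_trans x1 _.
  apply: exec_step => //=.
  rewrite -iterS iterSr.
  by rewrite (_ : t' + (n1 + n2.+1).+2 = (t'.+2 + n1).+1 + n2) //; lia.
Qed.

End Exec.
End Lang.

(** * Walks of least cost and efficient paths *)

Lemma mem_cat_split (T : eqType) (x : T) s :
  x \in s -> exists s1 s2, s = s1 ++ x :: s2.
Proof. by case/splitPr=> s1 s2; exists s1, s2. Qed.

Section Walks.
Variables (R : realType) (G : tgraph R).
Variables (ed : nat -> tedge R (nvert G)) (m : nat).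
Hypothesis loopless : forall i, i < m -> src (ed i) != tgt (ed i).
Hypothesis cost_gt0 : forall i, i < m -> (0 < cost (ed i))%R.

Definition fol i j := follows (ed i) (ed j).
(** Edges are referred to by number. Splitting off the first edge makes every walk nonempty;
    vertices and edges may repeat. *)
Definition walk i w := all (fun k => k < m) (i :: w) && path fol i w.
Definition arr i := avail (ed i) + trav (ed i).
Definition dur i j := arr j - avail (ed i).
Definition wcost (w : seq nat) : R := (\sum_(k <- w) cost (ed k))%R.

Lemma wcost_cons i w : wcost (i :: w) = (cost (ed i) + wcost w)%R.
Proof. exact: big_cons. Qed.

Lemma wcost_cat v w : wcost (v ++ w) = (wcost v + wcost w)%R.
Proof. exact: big_cat. Qed.

Lemma wcost_ge0 w : all (fun k => k < m) w -> (0 <= wcost w)%R.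
Proof.
move=> /allP h; rewrite /wcost big_seq; apply: sumr_ge0 => k /h km.
exact/ltW/cost_gt0.
Qed.

Lemma walk_cons i j w : walk i (j :: w) = [&& i < m, fol i j & walk j w].
Proof.
by rewrite /walk /=; case: (i < m); case: (fol i j) => //=; rewrite andbF.
Qed.

Lemma walk_cat i v j w : walk i (v ++ j :: w) =
  [&& walk i v, fol (last i v) j & walk j w].
Proof.
rewrite /walk -cat_cons all_cat cat_path /= -!andbA.
case: (i < m) => //=; case: (all _ v) => //=.
by case: (j < m); case: (all _ w); case: (path fol i v) => //=; rewrite !andbF.
Qed.

Lemma walk_last i w : walk i w -> last i w < m.
Proof. by case/andP=> /allP h _; apply/h/mem_last. Qed.

Lemma walk_avail i w j : walk i w -> j \in i :: w -> avail (ed i) <= avail (ed j).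
Proof.
elim: w i => [|k w IH] i; first by rewrite inE => _ /eqP->.
rewrite walk_cons => /and3P[_ /andP[_ ik] wk]; rewrite inE => /predU1P[->//|jw].
by have := IH _ wk jw; lia.
Qed.

Lemma walk_arr i w : walk i w -> arr i <= arr (last i w).
Proof.
elim: w i => [|k w IH] i //=; rewrite walk_cons => /and3P[_ /andP[_ ik] wk].
have := IH _ wk; rewrite /arr; lia.
Qed.

(** Induction from the front: the tail is made simple first. If it then enters the source of [i]
    through an edge [g], both [i] and everything up to [g] are dropped, so that the walk starts no
    earlier and costs less. The walk is also cut at its first arrival in [z]. The last clause
    records that any change is a strict gain. *)
Lemma walk_erase i w z :
  walk i w -> tgt (ed (last i w)) = z -> src (ed i) != z ->
  exists j q, [/\ walk j q, src (ed j) = src (ed i) /\ tgt (ed (last j q)) = z,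
    avail (ed i) <= avail (ed j) /\ arr (last j q) <= arr (last i w),
    uniq (src (ed j) :: [seq tgt (ed k) | k <- j :: q])
    & (j, q) = (i, w) \/ (wcost (j :: q) < wcost (i :: w))%R].
Proof.
elim: w i => [|k w IH] i.
  move=> wi lz sz; exists i, [::]; split; auto.
  by rewrite /= inE andbT; apply: loopless; case/andP: wi => /andP[].
rewrite walk_cons => /and3P[im ik wk] /= lz sz.
have [e eik] := andP ik; rewrite -/(arr i) in eik.
have ck : (0 <= wcost (k :: w))%R by apply: wcost_ge0; case/andP: wk.
have ci := cost_gt0 im.
have si := loopless im.
have [tz|tz] := eqVneq (tgt (ed i)) z.
  exists i, [::]; split=> //.
  - by rewrite /walk /= im.
  - split=> //=; apply: leq_trans (walk_arr wk); apply: leq_trans eik _.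
    exact: leq_addr.
  - by rewrite /= inE si.
  - have k0 : (0 < wcost (k :: w))%R.
      case/andP: wk => /andP[km wm] _; rewrite wcost_cons.
      by have := cost_gt0 km; have := wcost_ge0 wm; lra.
    right; rewrite [ltRHS]wcost_cons [ltLHS]wcost_cons.
    by rewrite /wcost big_nil -/(wcost _); lra.
rewrite (eqP e) in tz.
have [j [q [wj [sj lj] [avj arj] uj cj]]] := IH k wk lz tz.
have avi : arr i <= avail (ed j) := leq_trans eik avj.
have [sin|sin] := boolP (src (ed i) \in [seq tgt (ed k) | k <- j :: q]); last first.
  exists i, (j :: q); split=> //.
  - by rewrite walk_cons im wj /fol /follows (eqP e) sj eqxx -/(arr i) avi.
  - rewrite /= inE negb_or si sin (eqP e) -sj.
    exact: uj.
  - case: cj => [[-> ->]|cj]; [by left|right].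
    by rewrite wcost_cons [ltRHS]wcost_cons; lra.
case/mapP: sin => g gq eg.
have [A [[|b B] eA]] := mem_cat_split gq.
  (* If [g] were the last edge, its target [z] would be the source of [i], against [sz]. *)
  by move: lj sz; rewrite -(last_cons j j q) eA last_cat /= -eg => ->; rewrite eqxx.
have wb : walk b B /\ tgt (ed g) = src (ed b).
  case: A eA => [|a A] [-> eq] in wj *.
    by move: wj; rewrite eq walk_cons => /and3P[_ /andP[/eqP]].
  by move: wj; rewrite eq walk_cat walk_cons => /and3P[_ _ /and3P[_ /andP[/eqP]]].
case: wb => wb gb.
have lb : last b B = last j q by rewrite -(last_cons j j q) eA last_cat.
exists b, B; split.
- by [].
- by rewrite -gb -eg lb.
- rewrite lb; split; last exact: leq_trans arj _.
  have bq : b \in j :: q by rewrite eA mem_cat !inE eqxx !orbT.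
  by apply: leq_trans (walk_avail wj bq); apply: leq_trans avi; apply: leq_addr.
- move: uj; rewrite eA map_cat /= cat_uniq -gb => /and4P[_ _ _].
  by rewrite /=.
- right; have gm : g < m by case/andP: wj => /allP/(_ g gq).
  have jq : wcost (j :: q) = (wcost A + (cost (ed g) + wcost (b :: B)))%R.
    by rewrite eA wcost_cat wcost_cons.
  have A0 : (0 <= wcost A)%R.
    apply: wcost_ge0; case/andP: wj; rewrite eA all_cat => /andP[] //.
  have := cost_gt0 gm; have := wcost_cons i (k :: w).
  by case: cj => [[ej eq]|cj]; rewrite ?ej ?eq in jq; lra.
Qed.

(** Cutting at repeated edges rather than vertices keeps both end edges, as an entry of the distance
    matrix requires. With [uniq_walk_size] this bounds the number of relaxation rounds. *)
Lemma walk_shorten i w : walk i w ->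
  exists w', [/\ walk i w', last i w' = last i w, uniq (i :: w')
    & (wcost (i :: w') <= wcost (i :: w))%R].
Proof.
elim: w i => [|k w IH] i; first by exists [::]; split=> //.
rewrite walk_cons => /and3P[im ik /IH[q [wq lq uq cq]]].
have ci := cost_gt0 im.
have [iq|iq] := boolP (i \in k :: q); last first.
  exists (k :: q); split=> //.
  - by rewrite walk_cons im ik.
  - by rewrite cons_uniq iq.
  - by rewrite wcost_cons [leRHS]wcost_cons lerD2l.
have [A [B eA]] := mem_cat_split iq.
exists B; split=> /=.
- case: A eA => [|a A] [-> eq] in wq *; rewrite eq in wq => //.
  by move: wq; rewrite walk_cat => /and3P[].
- by rewrite -lq -(last_cons k k q) eA last_cat.
- by move: uq; rewrite eA cat_uniq => /and3P[].
- have e : wcost (k :: q) = (wcost A + wcost (i :: B))%R by rewrite eA wcost_cat.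
  have A0 : (0 <= wcost A)%R.
    by apply: wcost_ge0; case/andP: wq; rewrite eA all_cat => /andP[].
  have := wcost_cons i (k :: w); lra.
Qed.

Lemma uniq_walk_size i w : walk i w -> uniq (i :: w) -> size (i :: w) <= m.
Proof.
case/andP=> /allP im _ u; rewrite -(size_iota 0 m); apply: uniq_leq_size => //.
by move=> k /im; rewrite mem_iota.
Qed.

(* The entry 0 means that there is no walk; edge costs being positive, it is
   not the cost of a walk. *)
Definition dist_spec (D : nat -> nat -> R) :=
  (forall i j, i < m -> j < m -> (0 < D i j)%R ->
     exists w, [/\ walk i w, last i w = j & wcost (i :: w) = D i j]) /\
  (forall i w, walk i w -> (0 < D i (last i w) <= wcost (i :: w))%R).

(** * Cheapest walks between nondominated end edges *)

Section Solutions.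
Variables (D : nat -> nat -> R) (s z : 'I_(nvert G)).
Hypothesis DP : dist_spec D.

Definition ends e f :=
  [&& src (ed e) == s, tgt (ed f) == z & (0 < D e f)%R].
Definition dominates e' f' e f :=
  (D e' f' < D e f)%R && (dur e' f' <= dur e f) ||
  (D e' f' <= D e f)%R && (dur e' f' < dur e f).
(** The condition [s != z] excludes closed walks from [s], which may exist although no path leads
    from a vertex to itself. *)
Definition good e f :=
  [&& s != z, ends e f &
   all (fun e' => all (fun f' => ~~ (ends e' f' && dominates e' f' e f))
                      (iota 0 m)) (iota 0 m)].

Lemma good_nondominated e f e' f' : good e f -> e' < m -> f' < m ->
  ends e' f' -> ~~ dominates e' f' e f.
Proof.
case/and3P=> _ _ /allP h em fm en.
have /h/allP/(_ f') : e' \in iota 0 m by rewrite mem_iota.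
by rewrite mem_iota en; apply.
Qed.

Definition sol (w : seq nat) : bool :=
  if w is i :: w' then
    [&& walk i w', good i (last i w') & (wcost w <= D i (last i w'))%R]
  else false.

Lemma sol_cost i w : sol (i :: w) -> D i (last i w) = wcost (i :: w).
Proof.
case/and3P=> wi _ c; have /andP[_ c'] := DP.2 _ _ wi.
by apply/eqP; rewrite eq_le c c'.
Qed.

(** Were a vertex repeated, [walk_erase] would yield a strictly cheaper walk that takes no longer,
    and its end edges would dominate the pair at hand. *)
Lemma sol_simple i w : sol (i :: w) ->
  uniq (src (ed i) :: [seq tgt (ed k) | k <- i :: w]).
Proof.
move=> sw; have c := sol_cost sw.
case/and3P: sw => wi g _; case/and3P: (g) => sz /and3P[/eqP es /eqP et _] _.
have [|j [q [wj [sj tj] [av ar] u [[ej eq]|cj]]]] := walk_erase wi et.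
- by rewrite es.
- by rewrite -ej -eq.
have /andP[Dj0 Dj] := DP.2 _ _ wj.
have jm : j < m by case/andP: wj => /andP[].
have en : ends j (last j q) by rewrite /ends sj es tj !eqxx.
have := good_nondominated g jm (walk_last wj) en.
rewrite /dominates c (le_lt_trans Dj cj) negb_or => /andP[/negP[]].
exact: leq_sub.
Qed.

Lemma sol_size w : sol w -> size w <= m.
Proof.
case: w => // i w sw; apply: uniq_walk_size; first by case/and3P: sw.
have u : uniq [seq tgt (ed k) | k <- i :: w] by case/andP: (sol_simple sw).
exact: map_uniq u.
Qed.

Definition walk0 v := if v is i :: v' then walk i v' else true.
Definition fol0 v c := if v is i :: v' then fol (last i v') c else true.

(** A cheapest walk from [c] to [f] appended to [v] gives total cost at most [D (head c v) f], hence
    a solution; conversely, the part of a solution from [c] on costs at least [D c f]. [head c v] is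
    the first edge of [rcons v c] also when [v] is empty. *)
Lemma sol_prefixP v c : c < m -> walk0 v ->
  reflect (exists x, sol x /\ prefix (rcons v c) x)
    (fol0 v c &&
     has (fun f => [&& good (head c v) f, (0 < D c f)%R
                     & (wcost v + D c f <= D (head c v) f)%R]) (iota 0 m)).
Proof.
move=> cm wv; apply: (iffP idP).
  case/andP=> fv /hasP[f]; rewrite mem_iota /= => fm /and3P[g D0 cf].
  have [w [ww lw cw]] := DP.1 _ _ cm fm D0.
  exists (v ++ c :: w); split; last by rewrite -cat_rcons prefix_prefix.
  case: v wv fv g cf => [|i v] /= wv fv g cf.
    by rewrite ww lw g cw; move: cf; rewrite /wcost big_nil add0r.
  rewrite last_cat /= lw g walk_cat wv fv ww /=.
  by rewrite -cat_cons wcost_cat cw.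
case=> x [sx /prefixP[w ex]]; rewrite cat_rcons in ex; subst x.
have Dx : (wcost (v ++ c :: w) <= D (head c v) (last c w))%R.
  case: (v) sx => [|i v'] sx; rewrite -(sol_cost sx) //=.
  by rewrite last_cat.
have [wc gc fc] : [/\ walk c w, good (head c v) (last c w)
                     & fol0 v c].
  case: (v) sx => [|i v'] /= /and3P[].
    by rewrite /fol0 => -> ->.
  by rewrite walk_cat last_cat /= => /and3P[_ -> ->] ->.
rewrite fc; apply/hasP; exists (last c w).
  by rewrite mem_iota (walk_last wc).
have /andP[D0 D1] := DP.2 _ _ wc.
rewrite gc D0 /=; apply: le_trans Dx.
by rewrite wcost_cat lerD2l.
Qed.

(** * Solutions as efficient paths *)

Section Efficient.
Hypothesis ed_in : forall i, i < m -> ed i \in edges G.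
Variable idx : tedge R (nvert G) -> nat.
Hypothesis idxP : forall e, e \in edges G -> idx e < m /\ ed (idx e) = e.

Lemma tpath_map i w : all (fun k => k < m) (i :: w) ->
  tpath s z [seq ed k | k <- i :: w] =
  [&& walk i w, src (ed i) == s, tgt (ed (last i w)) == z
    & uniq (src (ed i) :: [seq tgt (ed k) | k <- i :: w])].
Proof.
move=> lm; rewrite (_ : tpath _ _ _ =
  [&& all (fun e => e \in edges G) [seq ed k | k <- i :: w], src (ed i) == s,
      tgt (last (ed i) [seq ed k | k <- w]) == z,
      path (@follows R G) (ed i) [seq ed k | k <- w]
    & uniq (src (ed i) :: [seq tgt e | e <- [seq ed k | k <- i :: w]])]) //.
rewrite last_map path_map -map_comp /walk lm (_ : all _ _ = true); last first.
  by apply/allP=> e /mapP[k kw ->]; apply/ed_in/(allP lm).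
rewrite (_ : path (relpre ed _) i w = path fol i w) //.
by case: (path fol i w); rewrite ?andbF.
Qed.

Lemma path_cost_map w : path_cost [seq ed k | k <- w] = wcost w.
Proof. exact: big_map. Qed.

Lemma duration_map i w : duration [seq ed k | k <- i :: w] = dur i (last i w).
Proof. by rewrite /duration /= last_map. Qed.

Lemma tpath_walk P : tpath s z P -> exists i w, [/\ P = [seq ed k | k <- i :: w],
  walk i w, s != z, ends i (last i w) & [seq idx e | e <- P] = i :: w].
Proof.
case: P => // e P tP; exists (idx e), [seq idx f | f <- P].
have /and5P[/allP aE /eqP es /eqP ez _ u] := tP.
have eP : e :: P = [seq ed k | k <- idx e :: [seq idx f | f <- P]].
  rewrite -map_cons -map_comp -[LHS]map_id; apply/eq_in_map => f /aE fE /=.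
  by rewrite (idxP fE).2.
have lm : all (fun k => k < m) (idx e :: [seq idx f | f <- P]).
  by rewrite -map_cons; apply/allP=> _ /mapP[f /aE fE ->]; case: (idxP fE).
have tP' := tP; rewrite eP tpath_map // in tP'.
case/and4P: tP' => w es' ez' _.
split=> //; last by rewrite /ends es' ez'; case/andP: (DP.2 _ _ w).
(* If [s = z], the target of the last edge repeats the starting vertex. *)
apply: contraTneq u => sz; rewrite negb_and negbK.
by apply/orP; left; rewrite es sz -ez; apply/map_f/mem_last.
Qed.

Lemma sol_efficient w : sol w -> efficient s z [seq ed k | k <- w].
Proof.
case: w => // i w sw; have c := sol_cost sw; have u := sol_simple sw.
case/and3P: sw => wi g _; case/and3P: (g) => sz /and3P[es et _] _.
split; first by rewrite tpath_map ?wi ?es ?et //; case/andP: wi.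
case=> Q [/tpath_walk[j [q [-> wj _ en _]]]].
rewrite !path_cost_map !duration_map => dom.
have jm : j < m by case/andP: wj => /andP[].
have /negP[] := good_nondominated g jm (walk_last wj) en.
have /andP[_ Dj] := DP.2 _ _ wj.
rewrite /dominates c; case: dom => -[h1 h2]; apply/orP; [left|right].
  by rewrite h2 (le_lt_trans Dj h1).
by rewrite h2 (le_trans Dj h1).
Qed.

Lemma efficient_sol P : efficient s z P ->
  sol [seq idx e | e <- P] /\ [seq ed k | k <- [seq idx e | e <- P]] = P.
Proof.
case=> /tpath_walk[i [w [eP wi sz en ->]]] nd; split=> //.
(* [nd] speaks of paths only; erasing turns a competing walk into a path that is no worse, so [P] is
   undominated among walks too. *)
have path_dom j q : walk j q -> ends j (last j q) ->
    ~ ((wcost (j :: q) < wcost (i :: w))%R /\ dur j (last j q) <= dur i (last i w) \/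
       (wcost (j :: q) <= wcost (i :: w))%R /\ dur j (last j q) < dur i (last i w)).
  move=> wj /and3P[/eqP js /eqP jt _] dom; apply: nd.
  have [|k [p [wk [sk tk] [av ar] u cj]]] := walk_erase wj jt; first by rewrite js.
  exists [seq ed l | l <- k :: p]; split.
    by rewrite tpath_map ?wk ?sk ?js ?tk ?eqxx -?js -?sk //; case/andP: wk.
  rewrite eP !path_cost_map !duration_map.
  have cle : (wcost (k :: p) <= wcost (j :: q))%R by case: cj => [[-> ->]|/ltW].
  have dle : dur k (last k p) <= dur j (last j q) by apply: leq_sub.
  case: dom => -[h1 h2]; [left|right]; split.
  - exact: le_lt_trans h1.
  - exact: leq_trans h2.
  - exact: le_trans h1.
  - exact: leq_ltn_trans h2.
have im : i < m by case/andP: wi => /andP[].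
have lm := walk_last wi.
have /andP[D0 D1] := DP.2 _ _ wi.
(* A cheaper walk with the same end edges would have the same duration and hence dominate. *)
have cD : (wcost (i :: w) <= D i (last i w))%R.
  have [q [wq lq cq]] := DP.1 _ _ im lm D0.
  rewrite leNgt; apply/negP => lt; apply: (path_dom i q) => //; rewrite lq //.
  by left; rewrite cq.
rewrite /= wi cD /good sz en !andbT /=.
apply/allP => e'; rewrite mem_iota => e'm; apply/allP => f'; rewrite mem_iota => f'm.
apply/negP => /andP[en' dom].
have /and3P[_ _ D0'] := en'.
have [q [wq lq cq]] := DP.1 _ _ e'm f'm D0'.
have {}cD : wcost (i :: w) = D i (last i w).
  by apply/eqP; rewrite eq_le cD D1.
apply: (path_dom e' q) => //; rewrite lq //.
by case/orP: dom => /andP[h1 h2]; [left|right]; rewrite cq cD.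
Qed.

End Efficient.
End Solutions.
End Walks.

(** * The program and its effect *)

Definition bor b1 b2 := BNot (BAnd (BNot b1) (BNot b2)).
(** Equality of naturals: the [n] refers to the type, not to a negation. *)
Definition neq_exp e1 e2 := BAnd (BNLe e1 e2) (BNLe e2 e1).
Definition rlt_exp r1 r2 := BNot (BRLe r2 r1).
Definition set_var v e := LSet v (NConst 0) e.
Definition mx_exp e1 e2 := NAdd (NMul e1 medges) e2.
Definition dist_exp e1 e2 := RCell 1 (mx_exp e1 e2).
Definition fol_exp e1 e2 :=
  BAnd (neq_exp (NCell 2 e1) (NCell 1 e2))
       (BNLe (NAdd (NCell 3 e1) (NCell 4 e1)) (NCell 3 e2)).
Definition dur_exp e1 e2 :=
  NSub (NAdd (NCell 3 e2) (NCell 4 e2)) (NCell 3 e1).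
Definition ends_exp e1 e2 :=
  BAnd (neq_exp (NCell 1 e1) (NCell 0 (NConst 2)))
  (BAnd (neq_exp (NCell 2 e2) (NCell 0 (NConst 3)))
        (rlt_exp RZero (dist_exp e1 e2))).
Definition dom_exp e' f' e f :=
  bor (BAnd (rlt_exp (dist_exp e' f') (dist_exp e f))
            (BNLe (dur_exp e' f') (dur_exp e f)))
      (BAnd (BRLe (dist_exp e' f') (dist_exp e f))
            (BNot (BNLe (dur_exp e f) (dur_exp e' f')))).

(* Memory map.  Naturals: 5 to 8, loop counters; 9, the matrix [good];
   10, a flag; 11, the stack of the search; 12, its height; 13, the edge to be
   tried next; 14, the first edge of the current walk; 15, set when an output
   is due.  Reals: 1, the distance matrix; 2, the costs of the prefixes of the
   stack. *)
Definition relax_prog :=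
  LIf (BAnd (fol_exp (nvar 6) (nvar 8))
      (BAnd (rlt_exp RZero (dist_exp (nvar 8) (nvar 7)))
            (bor (BRLe (dist_exp (nvar 6) (nvar 7)) RZero)
                 (BRLe (RAdd (RCell 0 (nvar 6)) (dist_exp (nvar 8) (nvar 7)))
                       (dist_exp (nvar 6) (nvar 7))))))
    (LRSet 1 (mx_exp (nvar 6) (nvar 7))
           (RAdd (RCell 0 (nvar 6)) (dist_exp (nvar 8) (nvar 7))))
    LSkip.

(** Bellman-Ford on pairs of edges, updating in place: when [k] follows [i], entry (i, j) may
    improve to the cost of [i] plus entry (k, j). The diagonal starts with the walks of one edge;
    loop 5 counts the rounds. *)
Definition dist_prog :=
  LSeq (LFor 6 (LRSet 1 (mx_exp (nvar 6) (nvar 6)) (RCell 0 (nvar 6))))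
       (LFor 5 (LFor 6 (LFor 7 (LFor 8 relax_prog)))).

Definition dominated_prog :=
  LFor 5 (LFor 8
    (LIf (BAnd (ends_exp (nvar 5) (nvar 8))
               (dom_exp (nvar 5) (nvar 8) (nvar 6) (nvar 7)))
         (set_var 10 (NConst 0)) LSkip)).

Definition good_prog :=
  LFor 6 (LFor 7
    (LSeq (LIf (BAnd (BNot (neq_exp (NCell 0 (NConst 2)) (NCell 0 (NConst 3))))
                     (ends_exp (nvar 6) (nvar 7)))
               (set_var 10 (NConst 1)) (set_var 10 (NConst 0)))
    (LSeq dominated_prog
          (LSet 9 (mx_exp (nvar 6) (nvar 7)) (nvar 10))))).

Definition good_exp e1 e2 := BNLe (NConst 1) (NCell 9 (mx_exp e1 e2)).

(** Evaluates the [has] of [sol_prefixP], with [f] in counter 6; cell 14 receives [head c v]. *)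
Definition check_prog :=
  LSeq (LIf (BNLe (nvar 12) (NConst 0)) (set_var 14 (nvar 13))
            (set_var 14 (nvar 11)))
  (LSeq (set_var 10 (NConst 0))
  (LFor 6
    (LIf (BAnd (good_exp (nvar 14) (nvar 6))
         (BAnd (rlt_exp RZero (dist_exp (nvar 13) (nvar 6)))
               (BRLe (RAdd (RCell 2 (nvar 12)) (dist_exp (nvar 13) (nvar 6)))
                     (dist_exp (nvar 14) (nvar 6)))))
         (set_var 10 (NConst 1)) LSkip))).

Definition ext_exp :=
  BAnd (BNLe (NConst 1) (nvar 10))
       (bor (BNLe (nvar 12) (NConst 0))
            (fol_exp (NCell 11 (NSub (nvar 12) (NConst 1))) (nvar 13))).

Definition push_prog :=
  LSeq (LSet 11 (nvar 12) (nvar 13))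
  (LSeq (LRSet 2 (NAdd (nvar 12) (NConst 1))
               (RAdd (RCell 2 (nvar 12)) (RCell 0 (nvar 13))))
  (LSeq (set_var 12 (NAdd (nvar 12) (NConst 1)))
  (LSeq (LIf (BAnd (good_exp (nvar 14) (nvar 13))
                   (BRLe (RCell 2 (nvar 12)) (dist_exp (nvar 14) (nvar 13))))
             (set_var 15 (NConst 1)) LSkip)
        (set_var 13 (NConst 0))))).

Definition pop_prog :=
  LSeq (set_var 12 (NSub (nvar 12) (NConst 1)))
       (set_var 13 (NAdd (NCell 11 (nvar 12)) (NConst 1))).

Definition body_prog :=
  LSeq (set_var 15 (NConst 0))
  (LIf (BNLe (NAdd (nvar 13) (NConst 1)) medges)
       (LSeq check_prog
             (LIf ext_exp push_prog
                  (set_var 13 (NAdd (nvar 13) (NConst 1)))))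
       pop_prog).

Section Programs.
Variables (R : realType) (G : tgraph R).
Variables (ed : nat -> tedge R (nvert G)) (m : nat) (src0 snk0 : 'I_(nvert G)).
Hypothesis loopless : forall i, i < m -> src (ed i) != tgt (ed i).
Hypothesis cost_gt0 : forall i, i < m -> (0 < cost (ed i))%R.
Implicit Type s : store R.
Local Notation fol := (fol ed).
Local Notation walk := (walk ed m).
Local Notation wcost := (wcost ed).

Definition input_loaded s : Prop :=
  [/\ gn s 0 1 = m, gn s 0 2 = src0 /\ gn s 0 3 = snk0,
      forall i, i < m -> gn s 1 i = src (ed i) /\ gn s 2 i = tgt (ed i),
      forall i, i < m -> gn s 3 i = avail (ed i) /\ gn s 4 i = trav (ed i)
    & forall i, i < m -> gr s 0 i = cost (ed i)].

Lemma input_den c s : wf c -> input_loaded s -> input_loaded (den c s).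
Proof.
move=> wc [h1 h2 h3 h4 h5].
by split=> [||i im|i im|i im]; rewrite ?(wf_gn, wf_gr) //; auto.
Qed.

Lemma input_setn s a i x : 5 <= a -> input_loaded s -> input_loaded (setn s a i x).
Proof.
move=> a5 [h1 h2 h3 h4 h5].
have e b j : b < 5 -> gn (setn s a i x) b j = gn s b j.
  by move=> b5; rewrite gn_setn; case: eqP => // ba; lia.
by split=> [||j jm|j jm|j jm]; rewrite ?e ?gr_setn //; auto.
Qed.

Lemma input_setr s a i x : 1 <= a -> input_loaded s -> input_loaded (setr s a i x).
Proof.
move=> a5 [h1 h2 h3 h4 h5].
split=> [||j jm|j jm|j jm]; rewrite ?gn_setr //; auto.
by rewrite gr_setr; case: eqP => [e|_]; [rewrite -e in a5|exact: h5].
Qed.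

(** A guarded write does nothing when its guard fails, so correctness has to discharge the guard at
    each write. *)
Lemma den_set s a i e : input_loaded s ->
  neval s i <= (m + 1) * (m + 1) -> neval s e <= m + 1 ->
  den (LSet a i e) s = setn s a (neval s i) (neval s e).
Proof. by case=> em _ _ _ _ hi he; rewrite /= em hi he. Qed.

Lemma den_rset s a i r : input_loaded s ->
  neval s i <= (m + 1) * (m + 1) ->
  den (LRSet a i r) s = setr s a (neval s i) (reval s r).
Proof. by case=> em _ _ _ _ hi; rewrite /= em hi. Qed.

Lemma den_set_var s v e : input_loaded s -> neval s e <= m + 1 ->
  den (set_var v e) s = setn s v 0 (neval s e).
Proof. by move=> il he; rewrite den_set. Qed.

Lemma mx_bound i j : i < m -> j < m -> i * m + j <= (m + 1) * (m + 1).
Proof. nia. Qed.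

Lemma mx_eq i j i' j' : j < m -> j' < m ->
  (i * m + j == i' * m + j') = (i == i') && (j == j').
Proof.
move=> jm j'm; apply/eqP/andP => [e|[/eqP-> /eqP->] //].
have m0 : 0 < m by case: (m) jm.
split; apply/eqP.
  by have := congr1 (divn^~ m) e; rewrite /= !divnMDl // !divn_small // !addn0.
by have := congr1 (modn^~ m) e; rewrite /= !modnMDl !modn_small.
Qed.

Lemma den_if s b c1 c2 :
  den (LIf b c1 c2) s = if beval s b then den c1 s else den c2 s.
Proof. by []. Qed.

Lemma den_seq s c1 c2 : den (LSeq c1 c2) s = den c2 (den c1 s).
Proof. by []. Qed.

Lemma beval_and s b1 b2 : beval s (BAnd b1 b2) = beval s b1 && beval s b2.
Proof. by []. Qed.

Lemma beval_rle s r1 r2 : beval s (BRLe r1 r2) = (reval s r1 <= reval s r2)%R.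
Proof. by []. Qed.

Lemma reval_add s r1 r2 : reval s (RAdd r1 r2) = (reval s r1 + reval s r2)%R.
Proof. by []. Qed.

Lemma nvarE s a : neval s (nvar a) = gn s a 0. Proof. by []. Qed.

Lemma neq_expE s e1 e2 : beval s (neq_exp e1 e2) = (neval s e1 == neval s e2).
Proof. by rewrite /= eqn_leq. Qed.

Lemma rlt_expE s r1 r2 : beval s (rlt_exp r1 r2) = (reval s r1 < reval s r2)%R.
Proof. by rewrite /= ltNge. Qed.

Lemma borE s b1 b2 : beval s (bor b1 b2) = beval s b1 || beval s b2.
Proof. by rewrite /= negb_and !negbK. Qed.

Definition dist s i j := gr s 1 (i * m + j).

Section Eval.
Variable s : store R.
Hypothesis il : input_loaded s.

Lemma mx_expE e1 e2 : neval s (mx_exp e1 e2) = neval s e1 * m + neval s e2.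
Proof. by case: il => em _ _ _ _; rewrite /= em. Qed.

Lemma dist_expE e1 e2 :
  reval s (dist_exp e1 e2) = dist s (neval s e1) (neval s e2).
Proof. by rewrite /dist -mx_expE. Qed.

Lemma cost_expE e : neval s e < m -> reval s (RCell 0 e) = cost (ed (neval s e)).
Proof. by case: il => _ _ _ _ h /h. Qed.

Lemma fol_expE e1 e2 : neval s e1 < m -> neval s e2 < m ->
  beval s (fol_exp e1 e2) = fol (neval s e1) (neval s e2).
Proof.
case: il => _ _ h3 h4 _ m1 m2.
have [_ t1] := h3 _ m1; have [s2 _] := h3 _ m2.
have [a1 l1] := h4 _ m1; have [a2 _] := h4 _ m2.
by rewrite /fol_exp [LHS]/= t1 s2 a1 l1 a2 -eqn_leq.
Qed.

Lemma dur_expE e1 e2 : neval s e1 < m -> neval s e2 < m ->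
  neval s (dur_exp e1 e2) = dur ed (neval s e1) (neval s e2).
Proof.
case: il => _ _ _ h4 _ m1 m2.
have [a1 _] := h4 _ m1; have [a2 l2] := h4 _ m2.
by rewrite [LHS]/= a1 a2 l2.
Qed.

Lemma ends_expE e1 e2 : neval s e1 < m -> neval s e2 < m ->
  beval s (ends_exp e1 e2) =
  ends ed (dist s) src0 snk0 (neval s e1) (neval s e2).
Proof.
case: (il) => _ [hs hz] h3 _ _ m1 m2.
have [s1 _] := h3 _ m1; have [_ t2] := h3 _ m2.
rewrite /ends -dist_expE /ends_exp.
have e a b : neval s (NCell a b) = gn s a (neval s b) by [].
by rewrite beval_and neq_expE beval_and neq_expE rlt_expE !e s1 t2 hs hz.
Qed.

Lemma dom_expE e1 e2 e3 e4 :
  neval s e1 < m -> neval s e2 < m -> neval s e3 < m -> neval s e4 < m ->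
  beval s (dom_exp e1 e2 e3 e4) =
  dominates ed (dist s) (neval s e1) (neval s e2) (neval s e3) (neval s e4).
Proof.
move=> m1 m2 m3 m4; rewrite /dom_exp borE.
rewrite !beval_and rlt_expE beval_rle -[beval s (BNLe _ _)]/(neval s _ <= neval s _).
rewrite -[beval s (BNot _)]/(~~ (neval s _ <= neval s _)).
by rewrite !dist_expE !dur_expE // -ltnNge.
Qed.

End Eval.

(** * Correctness of the relaxation *)

Definition dist_sound s := forall i j, i < m -> j < m -> (0 < dist s i j)%R ->
  exists w, [/\ walk i w, last i w = j & wcost (i :: w) = dist s i j].
Definition dist_below s i w := (0 < dist s i (last i w) <= wcost (i :: w))%R.

(** Since [w] omits the first edge, [r] rounds account for walks of up to [r.+1] edges. Only an
    inequality is claimed: updates in place may let longer walks in early. *)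
Definition dist_round r s := [/\ input_loaded s, dist_sound s &
  forall i w, walk i w -> size w <= r -> dist_below s i w].

(* [T i j k]: the walks from [i] to [j] with second edge [k] and at most [r]
   further edges have been taken into account. *)
Definition round_progress r (T : nat -> nat -> nat -> Prop) s :=
  dist_round r s /\ forall i k w, walk i (k :: w) -> size w <= r ->
    T i (last k w) k -> dist_below s i (k :: w).

Lemma progress_setn r T s v x : 5 <= v ->
  round_progress r T s -> round_progress r T (setn s v 0 x).
Proof. by move=> v5 [[il h1 h2] h3]; split=> //; split=> //; exact: input_setn. Qed.

Lemma progress_sub r (T T' : nat -> nat -> nat -> Prop) s :
  (forall i j k, i < m -> j < m -> k < m -> T' i j k -> T i j k) ->
  round_progress r T s -> round_progress r T' s.
Proof.
move=> h [h1 h2]; split=> // i k w wi sw t; apply: h2 => //; apply: h => //.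
- by case/andP: wi => /andP[].
- exact: walk_last wi.
- by case/andP: wi => /and3P[].
Qed.

(** A walk from [i] to [j] with second edge [k] costs at least the cost of [i] plus entry (k, j), so
    relaxing the triple settles it. What was settled before survives, because a positive entry is
    never raised. *)
Lemma relax_progress r T s : gn s 6 0 < m -> gn s 7 0 < m -> gn s 8 0 < m ->
  round_progress r T s ->
  round_progress r
    (fun i j k => T i j k \/ [/\ i = gn s 6 0, j = gn s 7 0 & k = gn s 8 0])
    (den relax_prog s).
Proof.
set i := gn s 6 0; set j := gn s 7 0; set k := gn s 8 0.
move=> im jm km [[il snd rnd] prg].
set cand := (cost (ed i) + dist s k j)%R.
have ci := cost_gt0 im.
rewrite /relax_prog den_if.
set b := beval s _.
have {b} -> : b = [&& fol i k, (0 < dist s k j)%R &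
    (dist s i j <= 0)%R || (cand <= dist s i j)%R].
  rewrite /b beval_and fol_expE // beval_and rlt_expE borE !beval_rle reval_add.
  by rewrite !(dist_expE il) (cost_expE il).
(* If nothing is written although a walk through [k] exists, the entry is positive and already below
   the candidate. *)
case: ifP => [/and3P[ik kj0 hij]|nrel]; last first.
  split=> // i' k' w wi sw [|[ei ej ek]]; first exact: prg.
  move: wi; rewrite ei ek walk_cons => /and3P[_ fik wk].
  rewrite ek in ej *; have kj := rnd _ _ wk sw; rewrite /dist_below ej in kj.
  case/andP: kj => kj0 kjw.
  move: nrel; rewrite fik kj0 /= => /negbT; rewrite negb_or -!ltNge => /andP[h1 h2].
  rewrite /dist_below /= ej h1 wcost_cons.
  by apply: le_trans (ltW h2) _; rewrite lerD2l.
rewrite den_rset //; last by rewrite (mx_expE il); apply: mx_bound.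
rewrite (mx_expE il) reval_add (dist_expE il) (cost_expE il) // -/cand.
rewrite ![neval _ _]/=.
set s' := setr _ _ _ _.
have d' i' j' : j' < m -> dist s' i' j' =
    if (i' == i) && (j' == j) then cand else dist s i' j'.
  by move=> j'm; rewrite /dist gr_setr mx_eq.
have cand0 : (0 < cand)%R by apply: addr_gt0.
have mono i' w : walk i' w -> dist_below s i' w -> dist_below s' i' w.
  move=> wi; rewrite /dist_below d'; last exact: walk_last wi.
  case: ifP => // /andP[/eqP -> /eqP ->] /andP[h1 h2]; rewrite cand0 /=.
  by move: hij; rewrite leNgt h1 /= => /le_trans; apply.
split; first split.
- exact: input_setr.
- move=> i' j' i'm j'm; rewrite d' //; case: ifP => [/andP[/eqP-> /eqP->]|_].
    have [w [wk lw cw]] := snd k j km jm kj0.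
    move=> _; exists (k :: w); split=> //; first by rewrite walk_cons im ik.
    by rewrite wcost_cons cw.
  exact: snd.
- by move=> i' w wi sw; apply/mono/rnd.
- move=> i' k' w wi sw [t|[ei ej ek]]; first by apply/mono/prg.
  move: wi; rewrite ei ek walk_cons => /and3P[_ fik wk].
  rewrite ek in ej *; have := rnd _ _ wk sw.
  rewrite /dist_below /= ej d' // !eqxx /= cand0 => /andP[_].
  by rewrite [wcost [:: i, _ & _]]wcost_cons lerD2l.
Qed.

Lemma gn_den_loop c s v : v \notin nwrites c -> forall i, gn s v 0 = i ->
  gn (den c s) v 0 = i.
Proof. by move=> vc i <-; apply: gn_den. Qed.

Lemma relax_row r T s i j : i < m -> j < m ->
  gn s 6 0 = i -> gn s 7 0 = j -> round_progress r T s ->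
  round_progress r (fun i' j' k => T i' j' k \/ i' = i /\ j' = j)
    (den (LFor 8 relax_prog) s).
Proof.
move=> im jm ei ej ps; have em : gn s 0 1 = m by case: ps => -[[]].
pose I l s := [/\ gn s 6 0 = i, gn s 7 0 = j & round_progress r
  (fun i' j' k => T i' j' k \/ [/\ i' = i, j' = j & k < l]) s].
have [|l s' x [e6 e7 p]|l s' lm e8 [e6 e7 p]|_ _] := @for_rule _ I 8 relax_prog s isT.
- split=> //; apply: progress_sub ps => i' j' k _ _ _ [//|[]] //.
- by split; rewrite ?gn_setn //; apply: progress_setn.
- rewrite em in lm; split; first exact: gn_den_loop.
    exact: gn_den_loop.
  apply: progress_sub (relax_progress _ _ _ p); rewrite ?e6 ?e7 ?e8 //.
  move=> i' j' k _ _ _ [t|[-> -> kl]]; first by left; left.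
  move: kl; rewrite ltnS leq_eqVlt => /orP[/eqP->|kl]; first by right.
  by left; right.
apply: progress_sub => i' j' k _ _ km; rewrite em.
by case=> [|[-> ->]]; [left|right].
Qed.

Lemma relax_matrix_row r T s i : i < m -> gn s 6 0 = i -> round_progress r T s ->
  round_progress r (fun i' j k => T i' j k \/ i' = i)
    (den (LFor 7 (LFor 8 relax_prog)) s).
Proof.
move=> im ei ps; have em : gn s 0 1 = m by case: ps => -[[]].
pose I l s := gn s 6 0 = i /\ round_progress r
  (fun i' j k => T i' j k \/ i' = i /\ j < l) s.
have [|l s' x [e6 p]|l s' lm e7 [e6 p]|_] :=
  @for_rule _ I 7 (LFor 8 relax_prog) s isT.
- split=> //; apply: progress_sub ps => i' j' k _ _ _ [//|[]] //.
- by split; rewrite ?gn_setn //; apply: progress_setn.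
- rewrite em in lm; split; first exact: gn_den_loop.
  apply: progress_sub (relax_row _ _ e6 e7 p) => //.
  move=> i' j' k _ _ _ [t|[-> kl]]; first by left; left.
  move: kl; rewrite ltnS leq_eqVlt => /orP[/eqP->|kl]; first by right.
  by left; right.
apply: progress_sub => i' j' k _ jm km; rewrite em.
by case=> [|->]; [left|right].
Qed.

(** A walk with one more edge is [i] followed by a walk that [r] rounds account for, and its triple
    is relaxed in this round. *)
Lemma relax_round r s : dist_round r s ->
  dist_round r.+1 (den (LFor 6 (LFor 7 (LFor 8 relax_prog))) s).
Proof.
move=> ps; have em : gn s 0 1 = m by case: ps => -[].
pose I l s := round_progress r (fun i _ _ => i < l) s.
have [//|l s' x p|l s' lm e6 p|[il snd rnd] prg] :=
  @for_rule _ I 6 (LFor 7 (LFor 8 relax_prog)) s isT.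
- exact: progress_setn.
- rewrite em in lm.
  apply: progress_sub (relax_matrix_row _ e6 p) => //.
  by move=> i' j' k _ _ _; rewrite ltnS leq_eqVlt => /orP[/eqP->|]; [right|left].
split=> // i [|k w] wi sw; first exact: rnd.
by apply: prg => //; rewrite em; case/andP: wi => /andP[].
Qed.

Lemma dist_progP s : input_loaded s ->
  (forall i j, i < m -> j < m -> dist s i j = 0%R) ->
  input_loaded (den dist_prog s) /\ dist_spec ed m (dist (den dist_prog s)).
Proof.
move=> il d0; have em : gn s 0 1 = m by case: il.
rewrite /dist_prog den_seq; set s1 := den (LFor 6 _) s.
have [il1 d1] : input_loaded s1 /\ forall i j, i < m -> j < m ->
    dist s1 i j = if i == j then cost (ed i) else 0%R.
  pose I l s := input_loaded s /\ forall i j, i < m -> j < m ->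
    dist s i j = if (i == j) && (i < l) then cost (ed i) else 0%R.
  have [|l s' x [il' d']|l s' lm e6 [il' d']|il1 d1] := @for_rule _ I 6
      (LRSet 1 (mx_exp (nvar 6) (nvar 6)) (RCell 0 (nvar 6))) s isT.
  - by split=> // i j im jm; rewrite andbF d0.
  - by split; first exact: input_setn.
  - rewrite em in lm; have e6' : neval s' (nvar 6) = l by [].
    rewrite den_rset //; last by rewrite (mx_expE il') e6' mx_bound.
    split; first exact: input_setr.
    move=> i j im jm; rewrite /dist gr_setr eqxx (mx_expE il') e6' mx_eq //.
    rewrite -/(dist _ _ _) d' // (cost_expE il') e6' // ltnS [in RHS]leq_eqVlt.
    by case: (i =P l) => [->|] //=; rewrite ltnn eq_sym andbF andbT.
  split=> // i j im jm; rewrite d1 //; case: eqP => //= _.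
  by rewrite em im.
have r0 : dist_round 0 s1.
  split=> [//|i j im jm|i [|k w] //].
    rewrite d1 //; case: eqP => [<- _|]; last by rewrite ltxx.
    exists [::]; rewrite wcost_cons /wcost big_nil addr0.
    by split=> //; rewrite /walk /= im.
  case/andP=> /andP[im _] _ _.
  by rewrite /dist_below /= d1 // eqxx cost_gt0 //= wcost_cons /wcost big_nil addr0.
have em1 : gn s1 0 1 = m by case: il1.
have [//|r s' x [il' h1 h2]|r s' rm _ rnd|il2 snd] := @for_rule _
    dist_round 5 (LFor 6 (LFor 7 (LFor 8 relax_prog))) s1 isT.
- by split=> //; exact: input_setn.
- exact: relax_round.
rewrite em1 => rnd; split=> //; split=> // i w wi.
(* [m] rounds are enough: a walk costs at least as much as one without repeated edges, which has at
   most [m] edges. *)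
have [w' [ww lw uw cw]] := walk_shorten cost_gt0 wi.
have sw := uniq_walk_size ww uw.
have := rnd _ _ ww (ltnW sw); rewrite /dist_below lw => /andP[-> /=].
by move=> h; apply: le_trans cw.
Qed.

(** * The table of nondominated pairs *)

Section Tables.
Variable D : nat -> nat -> R.

Definition dist_loaded s := input_loaded s /\ forall i j, dist s i j = D i j.

Lemma dist_loaded_setn s a i x : 5 <= a -> dist_loaded s -> dist_loaded (setn s a i x).
Proof. by move=> a5 [il h]; split=> //; apply: input_setn. Qed.

Lemma dist_loaded_den c s : wf c -> 1 \notin rwrites c ->
  dist_loaded s -> dist_loaded (den c s).
Proof.
move=> wc rc [il h]; split=> [|i j]; first exact: input_den.
by rewrite /dist gr_den //; apply: h.
Qed.

Lemma ends_loadedE s e1 e2 : dist_loaded s -> neval s e1 < m -> neval s e2 < m ->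
  beval s (ends_exp e1 e2) = ends ed D src0 snk0 (neval s e1) (neval s e2).
Proof. by move=> [il h] m1 m2; rewrite ends_expE // /ends h. Qed.

Lemma dom_loadedE s e1 e2 e3 e4 : dist_loaded s ->
  neval s e1 < m -> neval s e2 < m -> neval s e3 < m -> neval s e4 < m ->
  beval s (dom_exp e1 e2 e3 e4) =
  dominates ed D (neval s e1) (neval s e2) (neval s e3) (neval s e4).
Proof. by move=> [il h] m1 m2 m3 m4; rewrite dom_expE // /dominates !h. Qed.

Lemma all_iotaS (q : pred nat) l : all q (iota 0 l.+1) = all q (iota 0 l) && q l.
Proof. by rewrite -addn1 iotaD all_cat /= andbT. Qed.

Lemma has_iotaS (q : pred nat) l : has q (iota 0 l.+1) = has q (iota 0 l) || q l.
Proof. by rewrite -addn1 iotaD has_cat /= orbF. Qed.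

Let nondom i j e f := ~~ (ends ed D src0 snk0 e f && dominates ed D e f i j).

Lemma dominated_progP s i j (b : bool) : i < m -> j < m ->
  dist_loaded s -> gn s 6 0 = i -> gn s 7 0 = j -> gn s 10 0 = b ->
  gn (den dominated_prog s) 10 0 =
  b && all (fun e => all (nondom i j e) (iota 0 m)) (iota 0 m).
Proof.
move=> im jm dl e6 e7 e10; have em : gn s 0 1 = m by case: dl => -[].
pose body := LIf (BAnd (ends_exp (nvar 5) (nvar 8))
  (dom_exp (nvar 5) (nvar 8) (nvar 6) (nvar 7))) (set_var 10 (NConst 0)) LSkip.
pose I l s := [/\ dist_loaded s, gn s 6 0 = i, gn s 7 0 = j &
  gn s 10 0 = b && all (fun e => all (nondom i j e) (iota 0 m)) (iota 0 l)].
have [|l s' x [h1 h2 h3 h4]|l s' lm e5 [{}dl {}e6 {}e7 {}e10]|_ _ _] :=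
  @for_rule _ I 5 (LFor 8 body) s isT; last by rewrite em.
- by split=> //=; rewrite andbT.
- by split; rewrite ?gn_setn //; apply: dist_loaded_setn.
rewrite em in lm; set b' := b && _ in e10.
have em' : gn s' 0 1 = m by case: dl => -[].
pose J l' s := [/\ dist_loaded s, gn s 5 0 = l, gn s 6 0 = i, gn s 7 0 = j &
  gn s 10 0 = b' && all (nondom i j l) (iota 0 l')].
have [|l' t x [h1 h2 h3 h4 h5]|l' t l'm f8 [dt f5 f6 f7 f10]|h1 h2 h3 h4] :=
  @for_rule _ J 8 body s' isT.
- by split=> //=; rewrite andbT.
- by split; rewrite ?gn_setn //; apply: dist_loaded_setn.
- rewrite em' in l'm.
  split; try exact: gn_den_loop; first exact: dist_loaded_den.
  rewrite all_iotaS /body den_if beval_and.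
  rewrite ends_loadedE ?dom_loadedE // !nvarE ?f5 ?f6 ?f7 ?f8 //.
  rewrite [nondom i j l l']/nondom; case: ifP => _; last by rewrite /= andbT.
  by rewrite den_set_var //; [rewrite gn_setn /= !andbF|case: dt].
move=> h5; split=> //.
by rewrite h5 em' all_iotaS andbA.
Qed.

Lemma good_progP s : dist_loaded s -> dist_loaded (den good_prog s) /\
  forall i j, i < m -> j < m ->
    gn (den good_prog s) 9 (i * m + j) = good ed m D src0 snk0 i j.
Proof.
move=> dl; have em : gn s 0 1 = m by case: dl => -[].
pose gd := good ed m D src0 snk0.
pose I l s := dist_loaded s /\ forall i j, i < l -> i < m -> j < m ->
  gn s 9 (i * m + j) = gd i j.
pose body := LSeq (LIf (BAnd (BNot (neq_exp (NCell 0 (NConst 2)) (NCell 0 (NConst 3))))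
                     (ends_exp (nvar 6) (nvar 7)))
               (set_var 10 (NConst 1)) (set_var 10 (NConst 0)))
    (LSeq dominated_prog (LSet 9 (mx_exp (nvar 6) (nvar 7)) (nvar 10))).
have [//|l s' x [h1 h2]|l s' lm e6 [{}dl h]|h1 h2] :=
  @for_rule _ I 6 (LFor 7 body) s isT.
- split=> [|i j il im jm]; first exact: dist_loaded_setn.
  by rewrite gn_setn; apply: h2.
- rewrite em in lm; have em' : gn s' 0 1 = m by case: dl => -[].
  (* Lexicographic progress: the rows before [l] and the first [l'] entries of row [l] are
     filled. *)
  pose J l' s := [/\ dist_loaded s, gn s 6 0 = l & forall i j,
    (i < l) || (i == l) && (j < l') -> i < m -> j < m -> gn s 9 (i * m + j) = gd i j].
  have [|l' t x [h1 h2 h3]|l' t l'm f7 [dt f6 f9]|h1 h2 h3] :=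
    @for_rule _ J 7 body s' isT.
  + by split=> // i j; rewrite andbF orbF; exact: h.
  + split=> [||i j ij im jm]; rewrite ?gn_setn //; last exact: h3.
    exact: dist_loaded_setn.
  + rewrite em' in l'm.
    split; [exact: dist_loaded_den|exact: gn_den_loop|].
    rewrite /body !den_seq; set t1 := den (LIf _ _ _) t.
    have dt1 : dist_loaded t1 by apply: dist_loaded_den.
    have [g6 g7] : gn t1 6 0 = l /\ gn t1 7 0 = l' by split; exact: gn_den_loop.
    have g10 : gn t1 10 0 = (src0 != snk0) && ends ed D src0 snk0 l l'.
      have [[_ [hs hz] _ _ _] _] := dt.
      rewrite /t1 den_if beval_and -[beval t (BNot _)]/(~~ beval t (neq_exp _ _)).
      rewrite neq_expE ends_loadedE // !nvarE ?f6 ?f7 //.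
      rewrite -[neval t (NCell 0 (NConst 2))]/(gn t 0 2).
      rewrite -[neval t (NCell 0 (NConst 3))]/(gn t 0 3) hs hz.
      rewrite !den_set_var ?leq_addl //; try by case: dt.
      rewrite (_ : ((src0 : nat) == snk0) = (src0 == snk0)) //.
      by case: ifP => h'; rewrite gn_setn ?h'.
    have d10 := dominated_progP lm l'm dt1 g6 g7 g10.
    set t2 := den dominated_prog t1 in d10 *.
    have dt2 : dist_loaded t2 by apply: dist_loaded_den.
    have [k6 k7] : gn t2 6 0 = l /\ gn t2 7 0 = l' by split; exact: gn_den_loop.
    have k9 x : gn t2 9 x = gn t 9 x by rewrite !gn_den.
    have e6' : neval t2 (nvar 6) = l by [].
    have e7' : neval t2 (nvar 7) = l' by [].
    have [il2 _] := dt2.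
    have emx : neval t2 (mx_exp (nvar 6) (nvar 7)) = l * m + l'.
      by rewrite (mx_expE il2) e6' e7'.
    rewrite (den_set _ il2); first last.
    * by rewrite nvarE d10; case: (_ && _) => //; rewrite addn1.
    * by rewrite emx mx_bound.
    rewrite emx nvarE.
    move=> i j ij im jm; rewrite gn_setn eqxx mx_eq //=.
    case: (i =P l) => [ei|/eqP ni] /=; last first.
      rewrite k9; apply: f9 => //.
      by move: ij; rewrite (negPf ni).
    case: (j =P l') => [->|/eqP nj]; first by rewrite ei d10 /gd /good -andbA.
    rewrite k9; apply: f9 => //.
    by move: ij; rewrite ei eqxx (ltnS j) [j <= l']leq_eqVlt (negPf nj).
  split=> // i j il im jm; apply: h3 => //.
  by rewrite em' jm andbT orbC -leq_eqVlt.
by split=> // i j im jm; apply: h2; rewrite ?em.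
Qed.

(** * Moves of the depth-first search *)

Hypothesis DP : dist_spec ed m D.
Local Notation good := (good ed m D src0 snk0).
Local Notation sol := (sol ed m D src0 snk0).

Definition tables_loaded s := dist_loaded s /\
  forall i j, i < m -> j < m -> gn s 9 (i * m + j) = good i j.

(** [v] is the stack, bottom first, and [c] the edge to be tried next, [c = m] meaning that none is
    left. Real array 2 keeps the costs of all prefixes, because the machine cannot subtract reals
    when an edge is popped. Cells above the stack are unconstrained. *)
Definition search s v c :=
  [/\ tables_loaded s,
      [/\ gn s 12 0 = size v, gn s 13 0 = c, c <= m & size v <= m],
      forall i, i < size v -> gn s 11 i = nth 0 v i,
      forall i, i <= size v -> gr s 2 i = wcost (take i v)
    & walk0 ed m v].

Lemma search_input s v c : search s v c -> input_loaded s.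
Proof. by case=> -[[]]. Qed.

Lemma tables_setn s a i x : 5 <= a -> a != 9 ->
  tables_loaded s -> tables_loaded (setn s a i x).
Proof.
move=> a5 a9 [dl h]; split=> [|j k jm km]; first exact: dist_loaded_setn.
by rewrite gn_setn eq_sym (negPf a9); apply: h.
Qed.

Lemma search_den p s v c : wf p -> rwrites p = [::] ->
  ~~ has (mem [:: 9; 11; 12; 13]) (nwrites p) ->
  search s v c -> search (den p s) v c.
Proof.
move=> wp rp np [[dl hg] [h c' cm vm] hW hC wv].
have gp a i : a \in [:: 9; 11; 12; 13] -> gn (den p s) a i = gn s a i.
  move=> ain; apply: gn_den; apply: contra np => pa.
  by apply/hasP; exists a.
have rp' a i : gr (den p s) a i = gr s a i by rewrite gr_den // rp.
split=> //; rewrite ?gp //.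
- split=> [|i j im jm]; first by apply: dist_loaded_den; rewrite ?rp.
  by rewrite gp ?hg.
- by move=> i iv; rewrite gp ?hW.
- by move=> i iv; rewrite rp' hC.
Qed.

Lemma search_setn s v c a i x : 5 <= a -> a \notin [:: 9; 11; 12; 13] ->
  search s v c -> search (setn s a i x) v c.
Proof.
move=> a5 an [tl [h c' cm vm] hW hC wv].
have e b j : b \in [:: 9; 11; 12; 13] -> gn (setn s a i x) b j = gn s b j.
  by move=> bn; rewrite gn_setn; case: eqP => // ba; rewrite -ba bn in an.
split=> //; rewrite ?e //.
- by apply: tables_setn => //; apply: contraNneq an => ->.
- by move=> j jv; rewrite e ?hW.
Qed.

Lemma good_expE s e1 e2 : tables_loaded s -> neval s e1 < m -> neval s e2 < m ->
  beval s (good_exp e1 e2) = good (neval s e1) (neval s e2).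
Proof.
move=> [[il _] h] m1 m2.
rewrite -[LHS]/(1 <= gn s 9 (neval s (mx_exp e1 e2))) (mx_expE il) h //.
by case: good.
Qed.

Lemma dist_loadedE s e1 e2 : dist_loaded s ->
  reval s (dist_exp e1 e2) = D (neval s e1) (neval s e2).
Proof. by move=> [il h]; rewrite (dist_expE il) h. Qed.

Lemma walk0_all v : walk0 ed m v -> all (fun k => k < m) v.
Proof. by case: v => // i v /andP[]. Qed.

Lemma head_lt c v : c < m -> walk0 ed m v -> head c v < m.
Proof. by case: v => // i v _ /andP[/andP[]]. Qed.

Let ext_test v c f := [&& good (head c v) f, (0 < D c f)%R
                     & (wcost v + D c f <= D (head c v) f)%R].

Lemma check_progP s v c : c < m -> search s v c ->
  [/\ search (den check_prog s) v c, gn (den check_prog s) 14 0 = head c v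
    & gn (den check_prog s) 10 0 = has (ext_test v c) (iota 0 m)].
Proof.
move=> cm sr; set s' := den check_prog s.
have sr' : search s' v c by apply: search_den.
suff [h1 h2] : gn s' 14 0 = head c v /\
    gn s' 10 0 = has (ext_test v c) (iota 0 m) by [].
rewrite {sr'}/s' /check_prog !den_seq.
set s1 := den (LIf _ _ _) s.
have sr1 : search s1 v c by apply: search_den.
have e14 : gn s1 14 0 = head c v.
  case: (sr) => _ [h c' _ _] hW _ /walk0_all av; rewrite /s1 den_if.
  have il := search_input sr.
  rewrite -[beval _ _]/(gn s 12 0 <= 0) h.
  case: (v) hW av => [|i v'] hW av; rewrite [size _ <= 0]/=.
    by rewrite den_set_var // nvarE c' ?gn_setn // addn1 (leqW (ltnW cm)).
  have e11 : gn s 11 0 = i by rewrite (hW 0).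
  rewrite ltn0 den_set_var // nvarE e11 ?gn_setn // addn1.
  by case/andP: av => im _; apply/leqW/ltnW.
set s2 := den (set_var _ _) s1.
have sr2 : search s2 v c by apply: search_den.
have f14 : gn s2 14 0 = head c v by rewrite gn_den.
have f10 : gn s2 10 0 = 0.
  by rewrite /s2 den_set_var ?gn_setn //; apply: search_input sr1.
have em : gn s2 0 1 = m by case: (search_input sr2).
clearbody s2; clear s1 sr1 e14 sr.
pose I l s := [/\ search s v c, gn s 14 0 = head c v
  & gn s 10 0 = has (ext_test v c) (iota 0 l)].
set body := LIf _ _ _.
have [|l t x [h7 h8 h9]|l t lm e6 [sr e14 e10]|_ h2] :=
  @for_rule _ I 6 body s2 isT; last by rewrite em.
- by [].
- by split; rewrite ?gn_setn //; apply: search_setn.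
rewrite em in lm.
split; [exact: search_den|exact: gn_den_loop|].
have [tl [h c' _ _] _ hC wv] := sr.
have il := search_input sr.
have hm := head_lt cm wv.
rewrite /body den_if !beval_and good_expE ?nvarE ?e14 ?e6 //.
rewrite rlt_expE beval_rle reval_add !(dist_loadedE _ _ (proj1 tl)) !nvarE c' e6 e14.
rewrite -[reval t (RCell 2 _)]/(gr t 2 (gn t 12 0)) h hC // take_size.
rewrite -/(ext_test v c l) has_iotaS; case: ifP => _.
  by rewrite den_set_var ?gn_setn ?orbT // addn1.
by rewrite orbF.
Qed.

Lemma ext_expE s v c : c < m -> search s v c ->
  beval s ext_exp = (1 <= gn s 10 0) && fol0 ed v c.
Proof.
move=> cm sr; have il := search_input sr.
case: sr => _ [h c' _ _] hW _ wv.
rewrite beval_and borE -[beval s (BNLe (nvar 12) _)]/(gn s 12 0 <= 0) h.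
congr (_ && _); case: (v) h hW wv => [|i v'] h hW wv //; rewrite ltn0.
have e : neval s (NCell 11 (NSub (nvar 12) (NConst 1))) = last i v'.
  rewrite -[LHS]/(gn s 11 (gn s 12 0 - 1)) h subn1 hW //.
  exact: (nth_last 0 (i :: v')).
by rewrite fol_expE // ?e ?nvarE ?c' //; exact: walk_last wv.
Qed.

Lemma walk0_rcons v c : c < m -> walk0 ed m v -> fol0 ed v c -> walk0 ed m (rcons v c).
Proof.
case: v => [|i v] cm; first by rewrite /walk0 /walk /= cm.
by rewrite /= -cats1 walk_cat => -> ->; rewrite /walk /= cm.
Qed.

Lemma push_progP s v c : c < m -> size v < m -> fol0 ed v c -> search s v c ->
  gn s 14 0 = head c v -> gn s 15 0 = 0 ->
  search (den push_prog s) (rcons v c) 0 /\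
  gn (den push_prog s) 15 0 =
    good (head c v) c && (wcost (rcons v c) <= D (head c v) c)%R.
Proof.
move=> cm vm fv sr e14 e15; have il := search_input sr.
have [tl [h c' _ _] hW hC wv] := sr.
have hm := head_lt cm wv.
rewrite /push_prog !den_seq.
rewrite (den_set _ il) ?nvarE ?h ?c'; first last.
- by rewrite addn1; apply/leqW/ltnW.
- by nia.
set s1 := setn s _ _ _.
have tl1 : tables_loaded s1 by apply: tables_setn.
have il1 : input_loaded s1 by case: tl1 => -[].
have d12 : gn s1 12 0 = size v by rewrite gn_setn.
rewrite (den_rset _ _ il1); last first.
  by rewrite -[neval _ _]/(gn s1 12 0 + 1) d12; nia.
rewrite -[neval _ (NAdd _ _)]/(gn s1 12 0 + 1) reval_add.
rewrite -[reval _ (RCell 2 _)]/(gr s 2 (gn s1 12 0)) d12 hC // take_size.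
have -> : reval s1 (RCell 0 (nvar 13)) = cost (ed c).
  rewrite -[LHS]/(gr s1 0 (gn s1 13 0)).
  by case: il1 => _ _ _ _ ->; rewrite gn_setn /= c'.
rewrite addn1; set s2 := setr s1 _ _ _.
have dl2 : dist_loaded s2.
  case: tl1 => -[_ hd] _; split=> [|i j]; first exact: input_setr.
  by rewrite /dist gr_setr; apply: hd.
have il2 : input_loaded s2 by case: dl2.
rewrite (den_set_var _ il2); last first.
  by rewrite -[neval _ _]/(gn s1 12 0 + 1) d12; lia.
rewrite -[neval _ (NAdd _ _)]/(gn s1 12 0 + 1) d12 addn1.
set s3 := setn s2 _ _ _.
have tl3 : tables_loaded s3.
  case: tl1 => _ h9; split=> [|i j im jm]; first exact: dist_loaded_setn.
  by rewrite gn_setn; apply: h9.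
have il3 : input_loaded s3 by case: tl3 => -[].
have g12 : gn s3 12 0 = (size v).+1 by rewrite gn_setn.
have g13 : gn s3 13 0 = c by rewrite !(gn_setn, gn_setr).
have g14 : gn s3 14 0 = head c v by rewrite !(gn_setn, gn_setr).
have g15 : gn s3 15 0 = 0 by rewrite !(gn_setn, gn_setr).
have gW i : i < size (rcons v c) -> gn s3 11 i = nth 0 (rcons v c) i.
  rewrite size_rcons ltnS leq_eqVlt nth_rcons !(gn_setn, gn_setr) /=.
  by case: (i =P size v) => [->|_] //= iv; rewrite ?ltnn // iv hW.
have gC i : i <= size (rcons v c) -> gr s3 2 i = wcost (take i (rcons v c)).
  rewrite size_rcons leq_eqVlt gr_setn gr_setr eqxx ltnS.
  case: (i =P (size v).+1) => [-> _|_] /=.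
    rewrite -(size_rcons v c) take_size -cats1 wcost_cat wcost_cons.
    by rewrite /wcost big_nil addr0.
  by move=> iv; rewrite -[LHS]/(gr s 2 i) hC // -cats1 takel_cat.
set q := LIf _ _ _; set s4 := den q s3.
have e4 : gn s4 15 0 = good (head c v) c && (wcost (rcons v c) <= D (head c v) c)%R.
  rewrite /s4 den_if beval_and good_expE ?nvarE ?g14 ?g13 // beval_rle.
  rewrite (dist_loadedE _ _ (proj1 tl3)) !nvarE ?g14 ?g13.
  rewrite -[reval s3 (RCell 2 _)]/(gr s3 2 (gn s3 12 0)) g12 gC ?size_rcons //.
  rewrite -(size_rcons v c) take_size; case: ifP => _; last by rewrite /= g15.
  by rewrite den_set_var ?gn_setn // addn1.
have fr a : a != 15 -> forall i, gn s4 a i = gn s3 a i.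
  by move=> a15 i; rewrite gn_den //= inE.
have il4 : input_loaded s4 by apply: input_den.
rewrite den_set_var // [neval _ _]/=; split; last by rewrite gn_setn.
split.
- apply: tables_setn => //; split=> [|i j im jm].
    by apply: dist_loaded_den; case: tl3.
  by rewrite fr //; apply: (proj2 tl3).
- by rewrite !gn_setn /= fr // g12 size_rcons.
- by move=> i iv; rewrite gn_setn /= fr // gW.
- by move=> i iv; rewrite gr_setn gr_den // gC.
- exact: walk0_rcons.
Qed.

Lemma pop_progP s v x c : search s (rcons v x) c ->
  search (den pop_prog s) v x.+1.
Proof.
move=> sr; have il := search_input sr.
have [tl [h c' _ sm] hW hC wv] := sr; rewrite size_rcons in h sm.
have xm : x < m by have := walk0_all wv; rewrite all_rcons => /andP[].
rewrite /pop_prog den_seq (den_set_var _ il); last first.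
  by rewrite -[neval _ _]/(gn s 12 0 - 1) h; lia.
rewrite -[neval _ _]/(gn s 12 0 - 1) h subn1 [_.-1]/=.
set s1 := setn s _ _ _.
have tl1 : tables_loaded s1 by apply: tables_setn.
have il1 : input_loaded s1 by case: tl1 => -[].
have d12 : gn s1 12 0 = size v by rewrite gn_setn.
have e : neval s1 (NAdd (NCell 11 (nvar 12)) (NConst 1)) = x.+1.
  rewrite -[LHS]/(gn s1 11 (gn s1 12 0) + 1) gn_setn d12 hW ?size_rcons //.
  by rewrite nth_rcons ltnn eqxx addn1.
rewrite (den_set_var _ il1) e; last by rewrite addn1; apply: ltnW.
split.
- exact: tables_setn.
- by rewrite !gn_setn /=; split=> //; apply: ltnW.
- move=> i iv; rewrite !gn_setn /= hW ?size_rcons ?ltnS ?(ltnW iv) //.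
  by rewrite nth_rcons iv.
- move=> i iv; rewrite !gr_setn hC ?size_rcons ?(leqW iv) //.
  by rewrite -cats1 takel_cat.
- case: (v) wv => // i w; rewrite /= -cats1 walk_cat => /and3P[] //.
Qed.

Lemma body_progP s v c (s' := den body_prog s) : search s v c ->
  [/\ c < m -> (exists x, sol x /\ prefix (rcons v c) x) ->
        search s' (rcons v c) 0 /\ gn s' 15 0 = sol (rcons v c),
      c < m -> ~ (exists x, sol x /\ prefix (rcons v c) x) ->
        search s' v c.+1 /\ gn s' 15 0 = 0
    & forall w x, c = m -> v = rcons w x ->
        search s' w x.+1 /\ gn s' 15 0 = 0].
Proof.
move=> sr0; rewrite {}/s' /body_prog den_seq.
set s1 := den (set_var _ _) s.
have sr : search s1 v c by apply: search_den.
have il := search_input sr.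
have e15 : gn s1 15 0 = 0.
  by rewrite /s1 den_set_var ?gn_setn //; apply: search_input sr0.
clearbody s1; clear s sr0; rewrite den_if.
have [tl [h c' cm vm] hW hC wv] := sr.
have -> : beval s1 (BNLe (NAdd (nvar 13) (NConst 1)) medges) = (c < m).
  by rewrite -[LHS]/(gn s1 13 0 + 1 <= gn s1 0 1) c' addn1; case: il => ->.
case: ltnP => [{}cm|mc]; last first.
  split=> [||w x _ ev]; rewrite ?ltnNge ?mc //.
  rewrite ev in sr; split; first exact: pop_progP sr.
  by rewrite gn_den.
have [sr2 e14 e10] := check_progP cm sr.
have f15 : gn (den check_prog s1) 15 0 = 0 by rewrite gn_den.
rewrite den_seq den_if (ext_expE cm sr2) e10.
clear e10; set s2 := den check_prog s1 in sr2 e14 f15 *.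
have extP := sol_prefixP src0 snk0 DP cm wv.
have e (b : bool) : (1 <= b) = b by case: b.
rewrite e andbC.
split=> [_ ex|_ nex|w x ec]; last by rewrite ec ltnn in cm.
  (* Pruning bounds the height of the stack: the new stack is a prefix of a solution, and solutions
     have at most [m] edges. *)
  have vm' : size v < m.
    case: ex => x [sx px]; rewrite -(size_rcons v c).
    exact: leq_trans (size_prefix px) (sol_size loopless cost_gt0 DP sx).
  have /andP[fv he] := introT extP ex.
  rewrite (introT extP ex).
  have [sr3 ->] := push_progP cm vm' fv sr2 e14 f15.
  split=> //; congr nat_of_bool.
  move: (walk0_rcons cm wv fv); rewrite /sol; case: (v) => [|i v'] /= => -> //.
  by rewrite last_rcons.
rewrite (introF extP nex).
have il2 := search_input sr2.
have [tl2 [h2 c2 _ vm2] hW2 hC2 _] := sr2.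
rewrite (den_set_var _ il2) -[neval _ _]/(gn s2 13 0 + 1) c2 addn1; last first.
  by rewrite addn1; apply: leqW.
split; last by rewrite gn_setn.
split=> //; first exact: tables_setn.
  by rewrite !gn_setn.
by move=> i iv; rewrite gn_setn hW2.
Qed.

End Tables.

End Programs.

(** * The search *)

(** Written directly as machine code: [lcmd] has no output commands, and this loop stops at the
    height of the stack instead of the number of edges. *)
Definition emit_cmd :=
  CSeq (CNSet 6 (NConst 0) (NConst 0))
  (CSeq (CWhile (BNLe (NAdd (nvar 6) (NConst 1)) (nvar 12))
           (CSeq (CEmit (NCell 11 (nvar 6)))
                 (CNSet 6 (NConst 0) (NAdd (nvar 6) (NConst 1)))))
        CYield).

Definition iter_cmd :=
  CSeq (comp body_prog) (CIf (BNLe (NConst 1) (nvar 15)) emit_cmd CSkip).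

(** The sum vanishes exactly when the stack is empty and no first edge is left to try. *)
Definition main_cmd :=
  CWhile (BNLe (NConst 1) (NAdd (nvar 12) (NSub medges (nvar 13)))) iter_cmd.

Definition pre_prog := LSeq dist_prog good_prog.

Definition mcf_cmd := CSeq (comp pre_prog) main_cmd.

Lemma prefix_rconsE v c x : prefix (rcons v c) x =
  [&& prefix v x, size v < size x & nth 0 x (size v) == c].
Proof.
elim: v x => [|i v IH] [|j x] //=; first by rewrite prefix0s eq_sym andbT.
by rewrite IH ltnS andbA.
Qed.

(* A state of the search is the reversed stack [rv] with the next edge [c] to
   be tried on top of it.  The words still to be explored are those beginning
   with [rev rv] and a letter at least [c], and those of the states to which
   the search will backtrack. *)
Definition below (rv : seq nat) (c : nat) (x : seq nat) :=
  [&& prefix (rev rv) x, size rv < size x & c <= nth 0 x (size rv)].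

Fixpoint pending_word (rv : seq nat) (c : nat) (x : seq nat) : bool :=
  below rv c x || (if rv is y :: rv' then pending_word rv' y.+1 x else false).

Lemma belowS rv c x :
  below rv c x = prefix (rcons (rev rv) c) x || below rv c.+1 x.
Proof.
rewrite /below prefix_rconsE size_rev [c <= _]leq_eqVlt (eq_sym c).
by case: (prefix _ x); case: (_ < size x).
Qed.

Lemma prefix_push rv c x :
  prefix (rcons (rev rv) c) x = (x == rev (c :: rv)) || below (c :: rv) 0 x.
Proof.
rewrite /below rev_cons /= andbT.
apply/idP/orP => [p|[/eqP->|/andP[]//]]; last exact: prefix_refl.
have := size_prefix p; rewrite size_rcons size_rev leq_eqVlt => /orP[e|lt].
  left; case/prefixP: p e => w ->; rewrite size_cat size_rcons size_rev.
  by case: w => [|? ?] /=; rewrite ?cats0 //; lia.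
by right; rewrite p lt.
Qed.

Lemma pending_wordS rv c x :
  pending_word rv c x = prefix (rcons (rev rv) c) x || pending_word rv c.+1 x.
Proof. by case: rv => [|y rv] /=; rewrite belowS -orbA. Qed.

(** At every level of the stack the next edge to be tried exceeds the one that [x] has there. This
    is why no word is output twice. *)
Lemma pending_word_passed rv c x :
  prefix (rcons (rev rv) c) x -> pending_word rv c.+1 x = false.
Proof.
elim: rv c => [|y rv IH] c p /=.
  move: p; rewrite prefix_rconsE /below orbF => /and3P[_ _ /eqP->].
  by rewrite ltnn !andbF.
have p' : prefix (rcons (rev rv) y) x.
  by rewrite -rev_cons; move: p; rewrite prefix_rconsE => /and3P[].
rewrite IH // orbF /below; move: p; rewrite prefix_rconsE size_rev.
by case/and3P=> _ _ /eqP->; rewrite ltnn !andbF.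
Qed.

(** * Measures of the search *)

Section Measures.
Variables (m : nat) (sol : seq nat -> bool).
Hypothesis sol_lt : forall x, sol x -> all (fun k => k < m) x.

Definition live rv c := `[< exists x, sol x /\ below rv c x >].

(* While some solution lies [below] the state, the search does not backtrack
   before the next output. *)
Definition wait rv c :=
  if live rv c then (m - size rv) * m.+1 + (m - c)
  else size rv * m.+1 + (m - c) + m.+1 * m.+1.

(** Bounds the moves spent on top of one pushed edge, [j] levels being free before the push: each of
    [m] edges takes a move and its own subtree, and one move pops. The bound is exponential and
    serves termination only. *)
Fixpoint subtree j := if j is j'.+1 then m * (subtree j').+1 + 1 else 0.

Fixpoint steps_left rv c :=
  (m - c) * (subtree (m - size rv)).+1 + 1 +
  (if rv is y :: rv' then steps_left rv' y.+1 else 0).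

Lemma wait_max rv c : size rv <= m -> wait rv c < 2 * (m.+1 * m.+1).
Proof.
move=> rm; rewrite /wait; case: ifP => _.
  have : (m - size rv) * m.+1 <= m * m.+1 by rewrite leq_mul2r leq_subr orbT.
  nia.
have : size rv * m.+1 <= m * m.+1 by rewrite leq_mul2r rm orbT.
nia.
Qed.

Lemma live_end rv : live rv m = false.
Proof.
apply/negP => /asboolP[x [sx]]; rewrite /below => /and3P[_ sz h].
by have := allP (sol_lt sx) _ (mem_nth 0 sz); rewrite ltnNge h.
Qed.

(** Popping may lead to a live state; the offset [m.+1 * m.+1] of dead states exceeds every live
    value. Otherwise the level given up weighs [m.+1], more than the edges left on the level
    below. *)
Lemma wait_pop rv c : wait rv c.+1 < wait (c :: rv) m.
Proof.
rewrite {2}/wait live_end /wait /= subnn.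
case: ifP => _; last by nia.
have : (m - size rv) * m.+1 <= m * m.+1 by rewrite leq_mul2r leq_subr orbT.
nia.
Qed.

Lemma live_next rv c :
  ~ (exists x, sol x /\ prefix (rcons (rev rv) c) x) -> live rv c.+1 = live rv c.
Proof.
move=> np; apply/idP/idP => /asboolP[x [sx bx]]; apply/asboolP; exists x; split=> //.
  by rewrite belowS bx orbT.
by move: bx; rewrite belowS => /orP[p|//]; case: np; exists x.
Qed.

Lemma wait_next rv c : c < m ->
  ~ (exists x, sol x /\ prefix (rcons (rev rv) c) x) -> wait rv c.+1 < wait rv c.
Proof. by move=> cm np; rewrite /wait live_next //; case: ifP => _; lia. Qed.

(** As the new word is not itself a solution, the solution it leads to is strictly longer. The state
    thus stays live, and the level gained, weighing [m.+1], pays for restarting at edge 0. *)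
Lemma wait_push rv c : c < m -> size rv < m -> sol (rev (c :: rv)) = false ->
  (exists x, sol x /\ prefix (rcons (rev rv) c) x) -> wait (c :: rv) 0 < wait rv c.
Proof.
move=> cm rm ns [x [sx px]].
have l1 : live rv c by apply/asboolP; exists x; rewrite belowS px.
have l2 : live (c :: rv) 0.
  apply/asboolP; exists x; split=> //.
  by move: px; rewrite prefix_push => /orP[/eqP xe|//]; rewrite xe ns in sx.
rewrite /wait l1 l2 /= subn0 -(subnSK rm); nia.
Qed.

Lemma steps_left_next rv c : c < m -> steps_left rv c.+1 < steps_left rv c.
Proof.
by move=> cm; case: rv => [|y rv] /=; rewrite -(subnSK cm) mulSn; lia.
Qed.

Lemma steps_left_push rv c : c < m -> size rv < m ->
  steps_left (c :: rv) 0 < steps_left rv c.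
Proof.
move=> cm rm.
have -> : steps_left rv c = steps_left rv c.+1 + (subtree (m - size rv)).+1.
  by case: rv {rm} => [|y rv] /=; rewrite -(subnSK cm) mulSn; lia.
by rewrite /= subn0 -(subnSK rm) /=; lia.
Qed.

Lemma steps_left_pop rv c : steps_left rv c.+1 < steps_left (c :: rv) m.
Proof. by rewrite /= subnn; lia. Qed.

End Measures.

(** * Delay and termination of the search *)

Section Main.
Variables (R : realType) (G : tgraph R).
Variables (ed : nat -> tedge R (nvert G)) (m : nat) (src0 snk0 : 'I_(nvert G)).
Hypothesis loopless : forall i, i < m -> src (ed i) != tgt (ed i).
Hypothesis cost_gt0 : forall i, i < m -> (0 < cost (ed i))%R.
Variable s0 : store R.
Hypothesis s0n : size (nmem s0) = 5.
Hypothesis s0r : size (rmem s0) = 1.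
Hypothesis il0 : input_loaded ed m src0 snk0 s0.
Local Notation bounded := (bounded s0).
Local Notation exec := (exec s0).

Lemma s0m : gn s0 0 1 = m. Proof. by case: il0. Qed.

Lemma comp_exec_m c s k t w o : wf c -> bounded s ->
  exists n, [/\ n <= ((time c).[m])%R, bounded (den c s) &
    exec (Config (comp c :: k) s t w o) n (Config k (den c s) (t + n) w o)].
Proof.
move=> wc bs; have [n tn x] := comp_exec s0n s0r k t w o wc bs.
rewrite s0m in tn; exists n; split=> //.
exact: exec_bounded x.
Qed.

Lemma work_gn a i : 5 <= a -> gn s0 a i = 0.
Proof. by move=> a5; rewrite /rd (nth_default [::]) ?nth_nil // s0n. Qed.

Lemma work_gr a i : 1 <= a -> gr s0 a i = 0%R.
Proof. by move=> a1; rewrite /rd (nth_default [::]) ?nth_nil // s0r. Qed.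

Lemma pre_progP : exists2 D, dist_spec ed m D &
  search ed m src0 snk0 D (den pre_prog s0) [::] 0.
Proof.
have d0 i j : i < m -> j < m -> dist m s0 i j = 0%R by move=> _ _; apply: work_gr.
have [il1 DP] := dist_progP cost_gt0 il0 d0.
rewrite /pre_prog den_seq; set s1 := den dist_prog s0 in il1 DP *.
exists (dist m s1) => //.
have dl1 : dist_loaded ed m src0 snk0 (dist m s1) s1 by [].
have [dl2 g2] := good_progP dl1.
set s2 := den good_prog s1 in dl2 g2 *.
have e a i : a \in [:: 12; 13] -> gn s2 a i = 0.
  by rewrite !inE => /orP[]/eqP->; rewrite !gn_den // work_gn.
split=> //; first by rewrite !e.
by case=> // _; rewrite !gr_den // work_gr // /wcost big_nil.
Qed.

Section Loop.
Variable D : nat -> nat -> R.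
Hypothesis DP : dist_spec ed m D.
Local Notation search := (search ed m src0 snk0 D).
Local Notation sol := (sol ed m D src0 snk0).

Lemma emit_exec s v c k t o : search s v c -> bounded s -> exists n s',
  [/\ n <= 4 * m + 5, search s' v c &
    exec (Config (emit_cmd :: k) s t [::] o) n
         (Config k s' (t + n) [::] (rcons o (t + n, v)))].
Proof.
move=> sr bs; have [_ [_ _ _ vm] _ _ _] := sr.
set s1 := setn s 6 0 0.
have bs1 : bounded s1 by apply: bounded_setn.
have sr1 : search s1 v c by apply: search_setn.
set W := CWhile (BNLe (NAdd (nvar 6) (NConst 1)) (nvar 12))
           (CSeq (CEmit (NCell 11 (nvar 6)))
                 (CNSet 6 (NConst 0) (NAdd (nvar 6) (NConst 1)))).
(* Induction on the number [j] of edges still to print: four steps each, then the failing test and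
   [CYield]. *)
suff loop j s' t' : j <= size v -> search s' v c -> bounded s' ->
    gn s' 6 0 = size v - j -> exists2 s'', search s'' v c &
    exec (Config [:: W, CYield & k] s' t' (take (size v - j) v) o) (4 * j + 2)
         (Config k s'' (t' + (4 * j + 2)) [::] (rcons o (t' + (4 * j + 2), v))).
  have [|s2 sr2 x2] := loop (size v) s1 t.+3 (leqnn _) sr1 bs1.
    by rewrite gn_setn subnn.
  exists (4 * size v + 5), s2; split=> //; first by lia.
  rewrite (_ : 4 * size v + 5 = (4 * size v + 2).+3); last by lia.
  do 3![apply: exec_step => //=].
  rewrite subnn take0 in x2.
  by rewrite (_ : t + (4 * size v + 2).+3 = t.+3 + (4 * size v + 2)) //; lia.
elim: j s' t' => [|j IH] s' t' jv sr' bs' e6; have [_ [h _ _ _] hW _ _] := sr'.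
  exists s' => //; rewrite subn0 in e6 *; rewrite (_ : 4 * 0 + 2 = 2) // !addn2.
  apply: exec_step => //=; rewrite -/(gn s') e6 h addn1 ltnn.
  apply: exec_step => //=; rewrite take_size.
  exact: exec0.
set s2 := setn s' 6 0 (gn s' 6 0 + 1).
have sr2 : search s2 v c by apply: search_setn.
have jm : size v - j.+1 < size v by lia.
have bs2 : bounded s2.
  apply: bounded_setn => //; rewrite s0m e6; lia.
have [|s3 sr3 x3] := IH s2 (t' + 4) (ltnW jv) sr2 bs2.
  by rewrite gn_setn /= e6; lia.
exists s3 => //.
rewrite (_ : 4 * j.+1 + 2 = (4 * j + 2).+4); last by lia.
apply: exec_step => //=; rewrite -/(gn s') e6 h addn1 jm.
do 3![apply: exec_step => //=].
move: x3; rewrite -/(gn s') e6 hW // /s2 e6.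
rewrite (_ : size v - j = (size v - j.+1).+1); last by lia.
rewrite (take_nth 0) //.
rewrite (_ : t' + (4 * j + 2).+4 = t' + 4 + (4 * j + 2)); last by lia.
by rewrite -[t'.+4]addn4.
Qed.

(** Printing takes at most [4 * m + 5] steps, and the control around it 3. *)
Definition iter_time : {poly nat} := (time body_prog + 4%:P * 'X + 8%:P)%R.

Lemma iter_timeE : (iter_time.[m])%R = ((time body_prog).[m])%R + 4 * m + 8.
Proof.
rewrite /iter_time; move: (time body_prog) => p.
by rewrite !hornerD hornerM !hornerC hornerX.
Qed.

Lemma iter_exec s v c v' c' t o : search s v c -> bounded s ->
  (c < m) || (v != [::]) -> search (den body_prog s) v' c' ->
  exists n s' u,
  [/\ n <= (iter_time.[m])%R, search s' v' c', t <= u <= t + n &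
    exec (Config [:: main_cmd] s t [::] o) n
         (Config [:: main_cmd] s' (t + n) [::]
           (if gn (den body_prog s) 15 0 == 0 then o else rcons o (u, v')))].
Proof.
move=> sr bs go sr'.
have em : gn s 0 1 = m by case: (search_input sr).
have cond : beval s (BNLe (NConst 1) (NAdd (nvar 12) (NSub medges (nvar 13)))).
  have [_ [h c1 _ _] _ _ _] := sr.
  rewrite -[beval _ _]/(1 <= gn s 12 0 + (gn s 0 1 - gn s 13 0)) em h c1.
  by case: (v) go => [|? ?] /=; lia.
have [n1 [tn1 bs' x1]] := comp_exec_m
  [:: CIf (BNLe (NConst 1) (nvar 15)) emit_cmd CSkip; main_cmd] t.+2 [::] o
  (isT : wf body_prog) bs.
set s1 := den body_prog s in x1 bs' sr' *.
have start n cf :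
  exec (Config [:: CIf (BNLe (NConst 1) (nvar 15)) emit_cmd CSkip; main_cmd]
          s1 (t.+2 + n1) [::] o) n cf ->
  exec (Config [:: main_cmd] s t [::] o) (n1 + n).+2 cf.
  move=> x; rewrite /main_cmd; apply: exec_step => //; rewrite /step cond.
  by apply: exec_step => //; apply: exec_trans x1 x.
rewrite iter_timeE; case: eqP => [e15|n15].
  exists (n1 + 2).+2, s1, t; split=> //.
  - by lia.
  - by lia.
  apply: start; apply: exec_step => //; apply: exec_step => //=.
  rewrite -[rd 0 (nmem s1) 15 0]/(gn s1 15 0) e15 /=.
  rewrite (_ : t + _ = (t.+2 + n1).+2); last by lia.
  exact: exec0.
have [n2 [s2 [tn2 sr2 x2]]] := emit_exec [:: main_cmd] (t.+2 + n1).+1 o sr' bs'.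
exists (n1 + n2.+1).+2, s2, ((t.+2 + n1).+1 + n2); split=> //.
- by lia.
- by lia.
apply: start; apply: exec_step => //=.
rewrite -[rd 0 (nmem s1) 15 0]/(gn s1 15 0) lt0n (introN eqP n15).
by rewrite (_ : t + _ = (t.+2 + n1).+1 + n2) //; lia.
Qed.

Lemma sol_ltm x : sol x -> all (fun k => k < m) x.
Proof. by case: x => // i x /and3P[/andP[]]. Qed.

Let Tb := (iter_time.[m])%R.
Let wait := wait m sol.
Let wait_bound := 2 * (m.+1 * m.+1).

Section Budget.
Variable T0 : nat.
Let delay_ok (o : seq (nat * seq nat)) :=
  all (fun d => d <= T0 + wait_bound.+1 * Tb)
      (pairmap (fun t t' => t' - t) 0 (unzip1 o)).

(** The outputs so far are exactly the solutions no longer pending. The last clause is a potential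
    argument: the time since the last output plus [Tb] for each move still to wait stays within a
    fixed budget. [T0] covers the preprocessing, before the first output. *)
Definition loop_inv rv c s t (o : seq (nat * seq nat)) :=
  [/\ search s (rev rv) c /\ bounded s,
      uniq (unzip2 o),
      forall x, (x \in unzip2 o) = sol x && ~~ pending_word rv c x,
      delay_ok o
    & t + wait rv c * Tb <= last 0 (unzip1 o) + (T0 + wait_bound * Tb)].

Lemma loop_inv_step rv c s t o rv' c' :
  loop_inv rv c s t o -> (c < m) || (rev rv != [::]) ->
  search (den body_prog s) (rev rv') c' ->
  (gn (den body_prog s) 15 0 = 0 /\ wait rv' c' < wait rv c /\
   forall x, sol x -> pending_word rv c x = pending_word rv' c' x) \/
  ([/\ gn (den body_prog s) 15 0 != 0, sol (rev rv'),
     pending_word rv' c' (rev rv') = false &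
     forall x, sol x ->
       pending_word rv c x = (x == rev rv') || pending_word rv' c' x]) ->
  exists n s' o', loop_inv rv' c' s' (t + n) o' /\
    exec (Config [:: main_cmd] s t [::] o) n
         (Config [:: main_cmd] s' (t + n) [::] o').
Proof.
move=> [[sr bs] uo mo dl bt] go sr' h.
have [n [s' [u [tn sr2 /andP[tu ut] x]]]] := iter_exec t o sr bs go sr'.
have bs2 := exec_bounded x.
exists n, s'; case: h x => [[-> [wt pe]]|[n15 sv nv pe]] x.
  exists o; split=> //; split=> //.
    by move=> w; rewrite mo; case sw: (sol w) => //=; rewrite pe.
  apply: leq_trans bt; rewrite -addnA leq_add2l.
  apply: leq_trans (leq_add tn (leqnn _)) _.
  by rewrite -/Tb -mulSn leq_mul2r wt orbT.
rewrite (negPf n15) in x; exists (rcons o (u, rev rv')); split=> //.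
(* An output renews the budget: any state waits less than [wait_bound]. *)
have wm' : wait rv' c' < wait_bound.
  by apply: wait_max; case: sr2 => _ [_ _ _]; rewrite size_rev.
have {}wm' : n + wait rv' c' * Tb <= wait_bound * Tb.
  apply: leq_trans (leq_add tn (leqnn _)) _.
  by rewrite -/Tb -mulSn leq_mul2r wm' orbT.
split=> //.
- rewrite /unzip2 map_rcons rcons_uniq uo andbT mo sv /= pe // eqxx.
  by [].
- move=> w; rewrite /unzip2 map_rcons mem_rcons inE mo.
  case: eqP => [->|/eqP nw]; first by rewrite sv nv.
  by case sw: (sol w); rewrite //= pe // (negPf nw).
(* The move that prints is not paid for by a drop of [wait], hence the additional [Tb] in
   [delay_ok]. *)
- move: dl; rewrite /delay_ok /unzip1 map_rcons -cats1 pairmap_cat all_cat => -> /=.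
  rewrite andbT leq_subLR addnC -addnA.
  move: bt ut tn; rewrite mulSn -/Tb /unzip1.
  move: (last _ _) (wait rv c * Tb) => l w; lia.
- rewrite /unzip1 map_rcons last_rcons /=; lia.
Qed.

Lemma loop_exec N rv c s t o : steps_left m rv c <= N -> loop_inv rv c s t o ->
  exists n s' o', [/\ uniq (unzip2 o'), forall x, (x \in unzip2 o') = sol x,
    delay_ok o' &
    exec (Config [:: main_cmd] s t [::] o) n (Config [::] s' (t + n) [::] o')].
Proof.
elim: N rv c s t o => [|N IH] rv c s t o hN inv.
  by case: rv hN {inv} => [|? ?] /=; lia.
have cont rv' c' : steps_left m rv' c' < steps_left m rv c ->
    (exists n s' o', loop_inv rv' c' s' (t + n) o' /\
    exec (Config [:: main_cmd] s t [::] o) n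
         (Config [:: main_cmd] s' (t + n) [::] o')) ->
    exists n s' o', [/\ uniq (unzip2 o'), forall x, (x \in unzip2 o') = sol x,
    delay_ok o' &
    exec (Config [:: main_cmd] s t [::] o) n (Config [::] s' (t + n) [::] o')].
  move=> lt [n [s' [o' [inv' x]]]].
  have [|n2 [s2 [o2 [h1 h2 h3 x2]]]] := IH _ _ _ _ _ _ inv'; first by lia.
  exists (n + n2), s2, o2; split=> //; rewrite addnA.
  exact: exec_trans x x2.
have [[sr bs] uo mo dl bt] := inv.
have [_ [h c1 cm' rm] _ _ wv] := sr; rewrite size_rev in h rm.
have [b1 b2 b3] := body_progP loopless cost_gt0 DP sr.
have [mc|cm] := leqP m c.
  have ec : c = m by apply/eqP; rewrite eqn_leq cm' mc.
  (* No edge has number [m], so no solution lies below this state: the search pops, or halts if the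
     stack is empty. *)
  have pm w : sol w -> below rv c w = false.
    move=> sw; apply: contraFF (live_end sol_ltm rv) => bw.
    by apply/asboolP; exists w; split=> //; rewrite -ec.
  case: rv hN inv cont sr bs uo mo dl bt h rm wv b1 b2 b3 pm =>
    [|y rv] hN inv cont sr bs uo mo dl bt h rm wv b1 b2 b3 pm.
    exists 1, s, o; split=> //.
      by move=> w; rewrite mo; case sw: (sol w) => //=; rewrite pm.
    apply: exec_step => //.
    rewrite /step /main_cmd.
    rewrite -[beval _ _]/(1 <= gn s 12 0 + (gn s 0 1 - gn s 13 0)) h c1.
    rewrite (_ : gn s 0 1 = m); last by case: (search_input sr).
    by rewrite ec subnn addn1; apply: exec0.
  have [sr' e15] := b3 (rev rv) y ec (rev_cons _ _).
  apply: (cont rv y.+1); first by rewrite ec; apply: steps_left_pop.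
  apply: (loop_inv_step inv) => //.
    by rewrite -size_eq0 size_rev orbT.
  left; split=> //; split; first by rewrite ec; apply: wait_pop sol_ltm _ _.
  by move=> w sw; rewrite [LHS]/= pm.
have go : (c < m) || (rev rv != [::]) by rewrite cm.
have [ex|nex] := pselect (exists x, sol x /\ prefix (rcons (rev rv) c) x).
  have [sr' e15] := b1 cm ex; rewrite -rev_cons in sr' e15.
  have rm' : size rv < m.
    case: ex => x [sx px]; have := size_prefix px; rewrite size_rcons size_rev => sz.
    exact: leq_trans sz (sol_size loopless cost_gt0 DP sx).
  apply: (cont (c :: rv) 0); first exact: steps_left_push.
  apply: (loop_inv_step inv) => //.
  have pe w : pending_word rv c w = (w == rev (c :: rv)) || pending_word (c :: rv) 0 w.
    by rewrite pending_wordS prefix_push -orbA.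
  case sv: (sol (rev (c :: rv))) in e15.
    right; split=> //; first by rewrite e15.
    have p : prefix (rcons (rev rv) c) (rev (c :: rv)) by rewrite rev_cons prefix_refl.
    rewrite [LHS]/= (pending_word_passed p) orbF /below size_rev /= ltnn andbF //.
  left; split=> //; split; first exact: wait_push.
  by move=> w sw; rewrite pe; case: eqP => // ew; rewrite ew sv in sw.
have [sr' e15] := b2 cm nex.
apply: (cont rv c.+1); first exact: steps_left_next.
apply: (loop_inv_step inv) => //; left; split=> //; split; first exact: wait_next.
move=> w sw; rewrite pending_wordS; case: (boolP (prefix _ w)) => //= pw.
by case: nex; exists w.
Qed.

End Budget.
End Loop.

Lemma mcf_cmd_exec : exists D n s' o,
  [/\ dist_spec ed m D,
    uniq (unzip2 o), forall x, (x \in unzip2 o) = sol ed m D src0 snk0 x,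
    all (fun d => d <= ((time pre_prog).[m])%R + 1 +
           (2 * (m.+1 * m.+1)).+1 * (iter_time.[m])%R)
        (pairmap (fun t t' => t' - t) 0 (unzip1 o)) &
    exec (Config [:: mcf_cmd] s0 0 [::] [::]) n (Config [::] s' n [::] o)].
Proof.
have [D DP sr] := pre_progP.
have b0 : bounded s0 by apply: bounded0.
have [n1 [tn1 b1 x1]] :=
  comp_exec_m [:: main_cmd] 1 [::] [::] (isT : wf pre_prog) b0.
(* The 1 is the step that unfolds the outer [CSeq]. *)
set T0 := ((time pre_prog).[m])%R + 1.
have inv : loop_inv D T0 [::] 0 (den pre_prog s0) (1 + n1) [::].
  split=> //.
    move=> x; case sx: (sol _ _ _ _ _ x) => //=.
    by rewrite orbF /below prefix0s; case: x sx.
  rewrite /= add0n leq_add //; first by rewrite addnC leq_add2r.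
  by rewrite leq_mul2r (ltnW (wait_max _ _ _)) ?orbT.
have [n [s' [o [uo mo dl x]]]] := loop_exec DP (leqnn _) inv.
exists D, (n1 + n).+1, s', o; split=> //.
apply: exec_step => //; rewrite [step _]/=.
exact: exec_trans x1 x.
Qed.

End Main.

(** * Polynomial bounds in the input size *)

Lemma leq_horner (p : {poly nat}) a b : a <= b -> (p.[a])%R <= (p.[b])%R.
Proof.
move=> ab; rewrite !horner_coef; apply: (@leq_sum _ _ _) => i _.
rewrite leq_mul2l; apply/orP; right.
by elim: (nat_of_ord i) => // k IH; rewrite !exprS leq_mul.
Qed.

Definition delay_bound : {poly nat} :=
  (time pre_prog + 1 + (2%:P * (('X + 1) * ('X + 1)) + 1) * iter_time)%R.

Lemma delay_boundE m : (delay_bound.[m])%R =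
  ((time pre_prog).[m])%R + 1 + (2 * (m.+1 * m.+1)).+1 * (iter_time.[m])%R.
Proof.
rewrite /delay_bound; move: (time pre_prog) iter_time => p q.
rewrite !hornerD !hornerM !hornerD !hornerM !hornerD !hornerC !hornerX.
by rewrite -[(m + 1)%R]/(m + 1) addn1 -[((_ * _) + 1)%R]/(_ * _ + 1) addn1.
Qed.

Definition array_bound : {poly nat} := (('X + 1) * ('X + 1) + 1)%R.
(** ['X] accounts for the input arrays, whose space is at most the instance size; the rest is the
    bound on the scratch arrays. *)
Definition space_bound : {poly nat} :=
  ('X + 11%:P * (array_bound * ('X + 2%:P)) + 3%:P * array_bound)%R.

Lemma space_boundE m : (space_bound.[m])%R =
  m + 11 * ((m.+1 * m.+1).+1 * m.+2) + 3 * (m.+1 * m.+1).+1.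
Proof.
rewrite /space_bound /array_bound.
do !rewrite (hornerD, hornerM, hornerC, hornerX).
by rewrite -(addn1 (m.+1 * m.+1)) -(addn2 m) -(addn1 m).
Qed.

Section Instance.
Variables (R : realType) (x : mcf_inst R).
Let G := mcf_graph x.
Let m := size (edges G).
Hypothesis cpos : forall e, e \in edges G -> (0 < cost e)%R.
(** The default is a loop at [mcf_s x]: a vertex is at hand even if there is no edge. *)
Let ed i := nth (TEdge (mcf_s x) (mcf_s x) 0 0 0%R) (edges G) i.

Lemma ed_in i : i < m -> ed i \in edges G. Proof. exact: mem_nth. Qed.

Lemma ed_index e : e \in edges G ->
  index e (edges G) < m /\ ed (index e (edges G)) = e.
Proof. by move=> eE; rewrite index_mem /ed nth_index. Qed.

Lemma index_ed i : i < m -> index (ed i) (edges G) = i.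
Proof. by move=> im; rewrite index_uniq ?edges_uniq. Qed.

Lemma mcf_input_loaded : input_loaded ed m (mcf_s x) (mcf_z x) (mcf_store x).
Proof.
by split=> // i im; rewrite /rd /= -/G;
  rewrite ?(nth_map (TEdge (mcf_s x) (mcf_s x) 0 0 0%R)).
Qed.

Lemma mcf_size_ge : store_space (mcf_store x) <= mcf_size x.
Proof. exact: leq_addl. Qed.

Lemma nedges_le_size : m <= mcf_size x.
Proof.
apply: leq_trans mcf_size_ge; rewrite /store_space /= big_seq1 size_map.
exact: leq_addl.
Qed.

Lemma mcf_enumerated : exists (T : nat) (ys : seq (seq (tedge R (nvert G)))),
  let c := run mcf_cmd (mcf_store x) in
  [/\ todo (c T) = [::],
      uniq ys /\ (forall y, y \in ys <-> efficient (mcf_s x) (mcf_z x) y),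
      unzip2 (outs (c T)) = [seq [seq index e (edges G) | e <- y] | y <- ys],
      forall d, d \in delays (c T) -> d <= (delay_bound.[mcf_size x])%R
    & forall t, t <= T ->
        store_space (memory (c t)) <= (space_bound.[mcf_size x])%R].
Proof.
have loopless i : i < m -> src (ed i) != tgt (ed i).
  by move=> im; apply/edges_loopless/ed_in.
have cost_gt0 i : i < m -> (0 < cost (ed i))%R by move=> im; apply/cpos/ed_in.
have [D [n [s' [o [DP uo mo dl [xn xb]]]]]] :=
  mcf_cmd_exec loopless cost_gt0 (erefl : size (nmem (mcf_store x)) = 5)
    (erefl : size (rmem (mcf_store x)) = 1) mcf_input_loaded.
have so := sol_efficient loopless cost_gt0 DP ed_in ed_index.
have lt w : w \in unzip2 o -> all (fun k => k < m) w.
  by rewrite mo => /sol_ltm.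
(* The edge list has no repetition, so the positions output can be recovered from the path. *)
have back w : w \in unzip2 o -> [seq index e (edges G) | e <- [seq ed k | k <- w]] = w.
  move=> /lt/allP wm; rewrite -map_comp -[RHS]map_id; apply/eq_in_map => k /wm km.
  exact: index_ed.
exists n, [seq [seq ed k | k <- w] | w <- unzip2 o].
rewrite /run /= xn; split=> //.
- split.
    rewrite map_inj_in_uniq // => w w' wo w'o e.
    by rewrite -(back w wo) e back.
  move=> y; split=> [/mapP[w]|ey].
    by rewrite mo => sw ->; apply: so.
  have [sy ey'] := efficient_sol loopless cost_gt0 DP ed_in ed_index ey.
  by apply/mapP; exists [seq index e (edges G) | e <- y]; rewrite ?mo ?ey'.
- by rewrite -map_comp -[LHS]map_id; apply/eq_in_map => w /back.
- move=> d /(allP dl) h; apply: leq_trans (leq_horner _ nedges_le_size).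
  by rewrite delay_boundE.
move=> t tn; have := bounded_space (xb t tn).
rewrite -[gn (mcf_store x) 0 1]/m => h; apply: leq_trans h _.
rewrite space_boundE; have := mcf_size_ge; have := nedges_le_size.
move: (mcf_size x) (store_space _) m => N S k kN SN.
have kk : (k.+1 * k.+1).+1 <= (N.+1 * N.+1).+1 by rewrite ltnS leq_mul.
apply: leq_add; last by rewrite leq_mul2l.
by apply: leq_add => //; rewrite leq_mul2l /= leq_mul.
Qed.

End Instance.

Unset Implicit Arguments.

Theorem theorem2 (R : realType) : PSDelayP (cpos_McfEnum R).
Proof.
exists mcf_cmd, delay_bound, space_bound => -[x cpos].
exact: mcf_enumerated cpos.
Qed.
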